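(* Let $n\ge 2$ and consider a system of $n$ qudits with finite dimensions $d^{(1)},\dots,d^{(n)}\ge 2$ (not necessarily equal). Let $H$ be a Hamiltonian on this system that connects the set of all $n$ qudits (i.e. $H$ is entangling on this set). Then evolutions via $H$ together with single-qudit unitary operations are universal on the $n$ qudits if and only if $H$ is not an odd Hamiltonian acting on qubits alone. That is, universality fails exactly when $d^{(j)}=2$ for every $j$ and every coupling term in the Gell-Mann (Pauli) expansion of $H$ couples an odd number of qubits.
   Context: A qudit is any quantum system with a finite-dimensional state space $\mathbb{C}^d$, $d\ge 2$; a qubit is a qudit with $d=2$. The $n$-qudit system has state space $\bigotimes_{j=1}^n\mathbb{C}^{d^{(j)}}$, and a Hamiltonian is a Hermitian operator on it. Gell-Mann matrices. For a $d$-dimensional system with orthonormal basis $|1\rangle,\dots,|d\rangle$ these are the traceless Hermitian matrices $W_m=\frac{1}{\sqrt{m(m-1)}}\left(\sum_{b=1}^{m-1}|b\rangle\langle b|-(m-1)|m\rangle\langle m|\right)$ for $2\le m\le d$, and $X_{ab}=\frac{1}{\sqrt2}(|a\rangle\langle b|+|b\rangle\langle a|)$, $Y_{ab}=\frac{-i}{\sqrt2}(|a\rangle\langle b|-|b\rangle\langle a|)$ for $1\le a<b\le d$. They form a basis of the real vector space of traceless Hermitian $d\times d$ matrices (for $d=2$ they are the Pauli matrices up to scaling). Gell-Mann expansion. Every Hamiltonian can be written uniquely as $H=\sum_\alpha h_\alpha H_\alpha$ with $h_\alpha$ real and $H_\alpha=\bigotimes_{j=1}^n H_\alpha^{(j)}$,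 where each $H_\alpha^{(j)}$ is either the identity or a Gell-Mann matrix on qudit $j$. The terms of (or contained in) the expansion are those $H_\alpha$ with $h_\alpha\ne 0$. Let $S_\alpha$ be the set of qudits $j$ for which $H_\alpha^{(j)}$ is traceless (not the identity). One says that $H_\alpha$ couples the set $S_\alpha$; a coupling term is an $H_\alpha$ with $S_\alpha\neq\emptyset$ (the identity term is not a coupling term). Entangling/connecting. $H$ is entangling on (equivalently, connects) the set of $n$ qudits if that set cannot be partitioned into two non-empty sets $S,\bar S$ such that every coupling term $H_\alpha$ in the expansion of $H$ has $S_\alpha\subseteq S$ or $S_\alpha\subseteq\bar S$. Odd Hamiltonian. A Hamiltonian on a system of qubits only is odd if every coupling term in its expansion couples an odd number of qubits, i.e. $|S_\alpha|$ is odd. Simulation. Single-qudit unitary operations are the unitaries $U_1\otimes\cdots\otimes U_n$ with each $U_j$ an arbitrary unitary on qudit $j$. Given $H$ and single-qudit unitary operations, a Hamiltonian $K$ can be simulated if for every time $t\ge 0$ the evolution $e^{-iKt}$ can be approximated to arbitrary accuracy (in operator norm) by finite products of evolutions $e^{-iHs}$, $s\ge 0$, interleaved with single-qudit unitary operations. These resources are universal on a set of qudits if they can simulate every Hamiltonian on those qudits (no efficiency requirement). *)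

(* Defs.v *)
From HB Require Import structures.
From mathcomp Require Export all_boot all_order all_algebra.
From mathcomp Require Export sesquilinear spectral.
From mathcomp Require Export all_classical all_reals all_analysis.
From mathcomp Require Export complex.
Set Implicit Arguments.
Unset Strict Implicit.
Unset Printing Implicit Defensive.
Import Order.TTheory GRing.Theory Num.Theory.
Export numFieldNormedType.Exports.
Local Open Scope classical_set_scope.
Local Open Scope ring_scope.
Local Open Scope complex_scope.

(* The limit is entrywise, the scalars being R[i] with R : realType; the series
   always converges. *)
Definition expmx (R : realType) (N : nat) (A : 'M[R[i]]_N) : 'M[R[i]]_N :=
  limn (series (fun k : nat => (k`!%:R)^-1 *: A ^+ k)).

Definition l2norm (R : realType) (N : nat) (v : 'cV[R[i]]_N) : R :=
  Num.sqrt (\sum_i Normc.normc (v i 0) ^+ 2).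

(* The supremum is over a nonempty bounded set, so [sup] takes no default value. *)
Definition opnorm (R : realType) (N : nat) (A : 'M[R[i]]_N) : R :=
  sup [set l2norm (A *m v) | v in [set v : 'cV[R[i]]_N | l2norm v <= 1]].

(* The computational basis of the tensor product of the C^(d j): a basis state
   assigns to every qudit j an element of 'I_(d j).  Basis states of a single
   qudit are thus numbered from 0. *)
Definition config (n : nat) (d : 'I_n -> nat) : finType :=
  {dffun forall j : 'I_n, 'I_(d j)}.

(* Operators on the n-qudit space, as matrices whose rows and columns are the
   basis states taken in the order of [enum (config d)]. *)
Definition operator (R : realType) (n : nat) (d : 'I_n -> nat) : Type :=
  'M[R[i]]_#|config d|.

Definition digit (n : nat) (d : 'I_n -> nat) (x : 'I_#|config d|) (j : 'I_n) :
    'I_(d j) :=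
  (enum_val x : {dffun forall k : 'I_n, 'I_(d k)}) j.

Definition tensor (R : realType) (n : nat) (d : 'I_n -> nat)
    (A : forall j : 'I_n, 'M[R[i]]_(d j)) : operator R d :=
  \matrix_(x, y) \prod_(j < n) A j (digit x j) (digit y j).

Definition hamiltonian (R : realType) (n : nat) (d : 'I_n -> nat)
    (H : operator R d) : Prop := H \is hermsymmx.

Definition gmX (R : realType) (d : nat) (a b : 'I_d) : 'M[R[i]]_d :=
  (Num.sqrt 2)^-1%:C *: (delta_mx a b + delta_mx b a).

Definition gmY (R : realType) (d : nat) (a b : 'I_d) : 'M[R[i]]_d :=
  (- 'i * (Num.sqrt 2)^-1%:C) *: (delta_mx a b - delta_mx b a).

(* The usual W_m (2 <= m <= d, basis numbered from 1) is [gmW m] for the basis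
   state m of value m - 1, so that m (m - 1) reads m.+1 * m below. *)
Definition gmW (R : realType) (d : nat) (m : 'I_d) : 'M[R[i]]_d :=
  (Num.sqrt (m.+1 * m)%:R)^-1%:C *:
    (\sum_(b < d | (b < m)%N) delta_mx b b - m%:R *: delta_mx m m).

(* The identity and the d ^ 2 - 1 Gell-Mann matrices, indexed without repetition
   by the pairs (a, b): X_ab if a < b, Y_ba if b < a, and on the diagonal the
   identity at (0, 0) and W_(a+1) at (a, a) for a > 0. *)
Definition gell_mann (R : realType) (d : nat) (p : 'I_d * 'I_d) : 'M[R[i]]_d :=
  if (p.1 < p.2)%N then gmX R p.1 p.2
  else if (p.2 < p.1)%N then gmY R p.2 p.1
  else if val p.1 == 0%N then 1%:M else gmW R p.1.

Definition gm_index (n : nat) (d : 'I_n -> nat) : Type :=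
  {dffun forall j : 'I_n, ('I_(d j) * 'I_(d j))%type}.

Definition gm_basis (R : realType) (n : nat) (d : 'I_n -> nat)
    (alpha : gm_index d) : operator R d :=
  tensor (fun j => gell_mann R (alpha j)).

Definition gm_expansion (R : realType) (n : nat) (d : 'I_n -> nat)
    (H : operator R d) (h : gm_index d -> R) : Prop :=
  H = \sum_(alpha : gm_index d) (h alpha)%:C *: gm_basis R alpha.

(* H_alpha occurs in the expansion of H.  The family h is determined by H, since
   the [gm_basis R alpha] form a basis of the real space of Hermitian operators. *)
Definition gm_term (R : realType) (n : nat) (d : 'I_n -> nat)
    (H : operator R d) (alpha : gm_index d) : Prop :=
  exists2 h : gm_index d -> R, gm_expansion H h & h alpha != 0.

Definition coupled_set (R : realType) (n : nat) (d : 'I_n -> nat)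
    (alpha : gm_index d) : {set 'I_n} :=
  [set j | \tr (gell_mann R (alpha j)) == 0].

Definition coupling_term (R : realType) (n : nat) (d : 'I_n -> nat)
    (H : operator R d) (alpha : gm_index d) : Prop :=
  gm_term H alpha /\ coupled_set R alpha != finset.set0.

Definition connects_all (R : realType) (n : nat) (d : 'I_n -> nat)
    (H : operator R d) : Prop :=
  ~ exists S : {set 'I_n},
      [/\ S != finset.set0, ~: S != finset.set0 &
          forall alpha : gm_index d, coupling_term H alpha ->
            (coupled_set R alpha \subset S) || (coupled_set R alpha \subset ~: S)].

Definition odd_hamiltonian (R : realType) (n : nat) (d : 'I_n -> nat)
    (H : operator R d) : Prop :=
  (forall j : 'I_n, d j = 2%N) /\
  (forall alpha : gm_index d, coupling_term H alpha -> odd #|coupled_set R alpha|).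

Definition evolution (R : realType) (n : nat) (d : 'I_n -> nat)
    (H : operator R d) (t : R) : operator R d :=
  expmx ((- 'i * t%:C) *: H).

Inductive circuit (R : realType) (n : nat) (d : 'I_n -> nat)
    (H : operator R d) : operator R d -> Prop :=
| circuit_id : circuit H 1%:M
| circuit_evolution (s : R) (A : operator R d) :
    0 <= s -> circuit H A -> circuit H (evolution H s *m A)
| circuit_local (U : forall j : 'I_n, 'M[R[i]]_(d j)) (A : operator R d) :
    (forall j, U j \is unitarymx) -> circuit H A -> circuit H (tensor U *m A).

Definition can_simulate (R : realType) (n : nat) (d : 'I_n -> nat)
    (H K : operator R d) : Prop :=
  forall t : R, 0 <= t -> forall eps : R, 0 < eps ->
    exists2 A : operator R d, circuit H A & opnorm (A - evolution K t) < eps.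

Definition universal (R : realType) (n : nat) (d : 'I_n -> nat)
    (H : operator R d) : Prop :=
  forall K : operator R d, hamiltonian K -> can_simulate H K.

(* Main.v *)
Require Import Defs.
From mathcomp Require Import fingroup perm zify ring lra.
Set Implicit Arguments.
Unset Strict Implicit.
Unset Printing Implicit Defensive.
Import Order.TTheory GRing.Theory Num.Theory.
Local Open Scope classical_set_scope.
Local Open Scope ring_scope.
Local Open Scope complex_scope.
Local Open Scope sesquilinear_scope.

(** The Hamiltonians simulated by H and local unitaries form a closed convex cone that
is invariant under local conjugation.  Averaging over local unitaries turns any element
into a multiple of the identity, so the cone is a real vector space, and conjugating by
simulated evolutions makes it a Lie algebra for the bracket -i[.,.].  Real combinations
of conjugations by unitaries of one qudit contain all maps X |-> tr(AX)B with A, B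
traceless and Hermitian; hence as soon as H has a term coupling exactly the set S, the
Lie algebra contains every tensor of traceless Hermitian factors on S and identities
elsewhere (type S).  Commutators of tensors of types S and T, with two-level Pauli
matrices as factors, give the type (S + T) U J (S + T the symmetric difference) for
every J in the intersection of S and T with |J| odd, and more when a qudit in the
intersection has dimension greater than 2.  From one even coupling, or one qudit of
dimension greater than 2, connectedness yields all pairs and then all sets.

Conversely, on qubits let J be the tensor of the Pauli matrices Y.  Local unitaries U
satisfy U^T J U = cJ, and so does the evolution of an odd H because H^T J = J(2e - H),
where e is the coefficient of the identity.  Products and limits inherit the relation,
which the evolution of Z (x) Z violates. *)

(** They are needed before the bracket, because conjugating by the evolution of K also uses its
    inverse, the evolution of -K. The parity condition is a sign. If the two-level Pauli factors of
    two tensors anticommute on exactly |J| qudits and commute elsewhere, the two products are i^|J|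
    c and (-i)^|J| c, which differ exactly when |J| is odd. Dimension greater than 2 enters through
    a square: a two-level Pauli matrix squares to the projection onto its two levels. This is the
    identity for d = 2 but has a nonzero traceless part for d > 2, so that a qudit of the overlap
    can stay coupled without being counted in J. For the converse, Y X^T Y = tr X - X on 2 x 2
    matrices: traceless factors change sign and the identity is fixed. An odd number of traceless
    factors gives the sign -1, while the identity term keeps its sign, whence the scalar shift of
    H. *)

(** * Exponentials of diagonalised Hermitian matrices *)

Lemma cvg_lincomb (K : numFieldType) (V : normedModType K) (N : nat)
    (c : nat -> 'I_N -> K) (l : 'I_N -> K) (B : 'I_N -> V) :
  (forall i, (fun m => c m i) @ \oo --> l i) ->
  (fun m => \sum_i c m i *: B i) @ \oo --> \sum_i l i *: B i.
Proof.
move=> cl; apply: cvg_big => [|i _]; first exact: add_continuous.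
by apply: cvgZr_tmp; exact: cl.
Qed.

Lemma cvg_complex (R : realType) (a b : nat -> R) (x y : R) :
  a @ \oo --> x -> b @ \oo --> y ->
  (fun m => (a m +i* b m : (R[i] : numFieldType))) @ \oo -->
    (x +i* y : (R[i] : numFieldType)).
Proof.
move=> ax bx; apply/cvgrPdist_lt => e e0.
have e0' : 0 < complex.Re e by move: e0; rewrite ltcE => /andP[].
(* Norms over [R[i]] take values in [R[i]]; a positive e is comparable with 0 and hence real. *)
have ee : e = (complex.Re e)%:C.
  by move: e0; case: (e) => u v; rewrite ltcE /= => /andP[/eqP -> _].
have e2 : 0 < complex.Re e / 2 by rewrite divr_gt0.
move/cvgrPdist_lt: ax => /(_ _ e2) ax; move/cvgrPdist_lt: bx => /(_ _ e2) bx.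
near=> m.
have ha : `|x - a m| < complex.Re e / 2 by near: m.
have hb : `|y - b m| < complex.Re e / 2 by near: m.
have -> : (x +i* y : R[i]) - (a m +i* b m) = (x - a m)%:C + 'i * (y - b m)%:C by simpc.
apply: (le_lt_trans (ler_normD _ _)).
rewrite normrM !normc_def /= !(expr0n, addr0, add0r, expr1n, sqrtr1, mul1r) /=
  !sqrtr_sqr ee.
rewrite -rmorphD ltcR /= ; lra.
Unshelve. all: by end_near. Qed.

Lemma expmx_cvg (R : realType) (N : nat) (A L : 'M[R[i]]_N) :
   series (fun k : nat => (k`!%:R)^-1 *: A ^+ k) @ \oo -->
     (L : ('M[R[i]]_N : normedModType R[i])) -> expmx A = L.
Proof. move=> h; rewrite /expmx. exact: (cvg_lim (@norm_hausdorff _ _) h). Qed.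

Definition cis (R : realType) (x : R) : R[i] := cos x +i* sin x.

Lemma cvg_cis (R : realType) (x : R) :
  (fun m => \sum_(0 <= k < m) (k`!%:R)^-1 * ('i * x%:C) ^+ k : (R[i] : numFieldType)) @
    \oo --> (cis x : (R[i] : numFieldType)).
Proof.
have -> : (fun m => \sum_(0 <= k < m) (k`!%:R)^-1 * ('i * x%:C) ^+ k : R[i]) =
  (fun m => series (cos_coeff x) m +i* series (sin_coeff x) m).
  apply/funext => m; rewrite /series /=.
  elim: m => [|m IH]; first by rewrite !big_geq.
  rewrite !big_nat_recr //= IH.
  rewrite -[RHS]/((_ +i* _) + (_ +i* _)); congr (_ + _).
  rewrite cos_coeffE sin_coeffE /= exprMn -rmorphXn /=.
  have -> : (m`!%:R : R[i])^-1 = (m`!%:R^-1)%:C by rewrite fmorphV rmorph_nat.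
  (* The exponents are those of [cos_coeff] and [sin_coeff]; for odd m the integer halves of m and m
     - 1 agree. *)
  have -> : 'i ^+ m = (((~~ odd m)%:R * (-1) ^+ m./2) +i*
    ((odd m)%:R * (-1) ^+ m.-1./2)) :> R[i].
    rewrite -{1}(odd_double_half m) exprD -mul2n exprM sqr_i.
    have -> : (-1) ^+ m./2 = ((-1) ^+ m./2)%:C :> R[i] by rewrite rmorphXn rmorphN1.
    case o: (odd m) => /=; simpc => //=.
    by have -> : m.-1./2 = m./2 by rewrite -{1}(odd_double_half m) o doubleK.
  by simpc; congr (_ +i* _); ring.
apply: cvg_complex; rewrite ?cos.unlock ?sin.unlock.
- exact: is_cvg_series_cos_coeff.
- exact: is_cvg_series_sin_coeff.
Qed.

Lemma unitarymxK (C : numClosedFieldType) (N : nat) (P : 'M[C]_N) :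
  P \is unitarymx -> P^t* *m P = 1%:M.
Proof. by move/unitarymxP; exact: mulmx1C. Qed.

Lemma adj_mulmx (C : numClosedFieldType) (m n p : nat) (A : 'M[C]_(m, n))
  (B : 'M[C]_(n, p)) :
  (A *m B)^t* = B^t* *m A^t*.
Proof. by rewrite trmx_mul map_mxM. Qed.

(** For unitary P, the operator with spectrum d in the orthonormal basis of columns of the adjoint
    of P. Keeping d as a function turns functional calculus into pointwise operations. *)
Definition udiag (C : numClosedFieldType) (N : nat) (P : 'M[C]_N) (d : 'I_N -> C) :
  'M[C]_N :=
  P^t* *m diag_mx (\row_k d k) *m P.

Section Udiag.
Variables (C : numClosedFieldType) (N : nat) (P : 'M[C]_N).
Implicit Types d e : 'I_N -> C.

Lemma udiagE d : udiag P d = \sum_k d k *: (P^t* *m delta_mx k k *m P).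
Proof.
rewrite /udiag.
have -> : diag_mx (\row_k d k) = \sum_k d k *: delta_mx k k.
  by rewrite diag_mx_sum_delta; apply: eq_bigr => k _; rewrite mxE.
rewrite mulmx_sumr mulmx_suml; apply: eq_bigr => k _.
by rewrite -scalemxAr -scalemxAl.
Qed.

Lemma eq_udiag d e : d =1 e -> udiag P d = udiag P e.
Proof. by move=> de; rewrite !udiagE; apply: eq_bigr => k _; rewrite de. Qed.

Lemma udiagD d e : udiag P d + udiag P e = udiag P (fun k => d k + e k).
Proof. by rewrite !udiagE -big_split; apply: eq_bigr => k _; rewrite scalerDl. Qed.

Lemma udiagZ a d : a *: udiag P d = udiag P (fun k => a * d k).
Proof. by rewrite !udiagE scaler_sumr; apply: eq_bigr => k _; rewrite scalerA. Qed.

Lemma udiag_adj d : (udiag P d)^t* = udiag P (fun k => (d k)^*)%R.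
Proof.
rewrite /udiag !adj_mulmx trmxCK -mulmxA tr_diag_mx map_diag_mx.
by congr (_ *m (_ *m _)); congr diag_mx; apply/rowP => k; rewrite !mxE.
Qed.

Hypothesis uP : P \is unitarymx.

Lemma udiag_cst a : udiag P (fun=> a) = a%:M.
Proof.
rewrite /udiag; have -> : diag_mx (\row_k a) = a%:M :> 'M[C]_N.
  by rewrite -diag_const_mx; congr diag_mx; apply/rowP => k; rewrite !mxE.
by rewrite mul_mx_scalar -scalemxAl unitarymxK // scalemx1.
Qed.

Lemma udiagM d e : udiag P d *m udiag P e = udiag P (fun k => d k * e k).
Proof.
rewrite /udiag !mulmxA -[_ *m P *m P^t*]mulmxA (unitarymxP uP) mulmx1.
rewrite -[P^t* *m _ *m _]mulmxA mulmx_diag.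
by congr (_ *m diag_mx _ *m _); apply/rowP => k; rewrite !mxE.
Qed.

Lemma udiagX d m : udiag P d ^+ m = udiag P (fun k => d k ^+ m).
Proof.
elim: m => [|m IH]; first by rewrite expr0 udiag_cst.
by rewrite exprS IH -mulmxE udiagM; apply: eq_udiag => k; rewrite exprS.
Qed.

Lemma udiag_unitary d : (forall k, d k * (d k)^* = 1)%R -> udiag P d \is unitarymx.
Proof.
by move=> h; apply/unitarymxP; rewrite udiag_adj udiagM (eq_udiag h) udiag_cst.
Qed.
End Udiag.

Lemma hermitian_udiagC (C : numClosedFieldType) (N : nat) (H : 'M[C]_N) : H \is
  hermsymmx ->
  exists P (x : 'I_N -> C),
    [/\ P \is unitarymx, forall k, x k \is Num.real & H = udiag P x].
Proof.
move=> hH; exists (spectralmx H), (fun k => spectral_diag H 0 k); split.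
- exact: spectral_unitarymx.
- by move=> k; exact: (mxOverP (hermitian_spectral_diag_real hH)).
have /orthomx_spectralP {1}-> := hermitian_normalmx hH.
rewrite invmx_unitary ?spectral_unitarymx // /udiag.
by congr (_ *m diag_mx _ *m _); apply/rowP => k; rewrite !mxE.
Qed.

(** The spectral projections are the same in every partial sum, so convergence of matrices is
    convergence of one scalar series per eigenvalue. *)
Lemma expmx_udiag (R : realType) (N : nat) (P : 'M[R[i]]_N) (x : 'I_N -> R) :
  P \is unitarymx -> expmx (udiag P (fun k => 'i * (x k)%:C)) =
    udiag P (fun k => cis (x k)).
Proof.
move=> uP; apply: expmx_cvg.
rewrite [X in _ --> X]udiagE.
rewrite [X in X @ _](_ : _ = fun m =>
  \sum_l (\sum_(0 <= k < m) (k`!%:R)^-1 * ('i * (x l)%:C) ^+ k) *: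
    (P^t* *m delta_mx l l *m P)); last first.
  apply/funext => m; rewrite /series /=.
  under eq_bigr do rewrite udiagX // udiagE scaler_sumr.
  rewrite exchange_big; apply: eq_bigr => l _.
  by rewrite scaler_suml; apply: eq_bigr => k _; rewrite scalerA.
apply: cvg_lincomb => l; exact: cvg_cis.
Qed.

Lemma hermitian_udiag (R : realType) (N : nat) (H : 'M[R[i]]_N) : H \is hermsymmx ->
  exists P (x : 'I_N -> R), P \is unitarymx /\ H = udiag P (fun k => (x k)%:C).
Proof.
move=> /hermitian_udiagC [P [x [uP rx ->]]].
exists P, (fun k => complex.Re (x k)); split; first exact: uP.
by apply: eq_udiag => k; rewrite RRe_real.
Qed.

(** Convertible with [evolution], but free of the tensor structure, so that the analysis applies to
    any matrix size. *)
Definition evol (R : realType) (N : nat) (H : 'M[R[i]]_N) (t : R) :=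
  expmx ((- 'i * t%:C) *: H).

Lemma evol_udiag (R : realType) (N : nat) (P : 'M[R[i]]_N) (x : 'I_N -> R) t :
  P \is unitarymx -> evol (udiag P (fun k => (x k)%:C)) t =
    udiag P (fun k => cis (- (t * x k))).
Proof.
move=> uP.
have <- := expmx_udiag (fun k => - (t * x k)) uP.
apply: (congr1 (@expmx R N)).
apply: etrans (udiagZ _ _ _) _.
apply: eq_udiag => k.
by rewrite rmorphN rmorphM /=; ring.
Qed.

(** * Matrix norm and evolutions *)

Section Cis.
Variable R : realType.
Implicit Types x y : R.
Local Notation normc := (@Normc.normc R).

Lemma cis0 : cis 0 = 1 :> R[i].
Proof. by rewrite /cis cos0 sin0. Qed.

Lemma cisD x y : cis (x + y) = cis x * cis y.
Proof. by rewrite /cis cosD sinD; simpc; congr (_ +i* _); ring. Qed.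

Lemma cisX x m : cis x ^+ m = cis (m%:R * x).
Proof.
elim: m => [|m IH]; first by rewrite mul0r cis0.
by rewrite exprS IH -cisD; congr cis; rewrite -natr1; ring.
Qed.

Lemma cisJ x : ((cis x)^*)%R = cis (- x).
Proof. by rewrite /cis cosN sinN. Qed.

Lemma cisMJ x : (cis x * (cis x)^* = 1)%R.
Proof. by rewrite cisJ -cisD subrr cis0. Qed.

(** Mean value theorem from 0 for x of either sign. The bound |c| <= |x| turns a linear estimate of
    [df] into a quadratic estimate of f. *)
Lemma MVT0 (f df : R -> R) (x : R) : (forall z : R, is_derive z 1 f (df z)) ->
  exists2 c, `|c| <= `|x| & f x - f 0 = df c * x.
Proof.
move=> fdf.
have fc (a b : R) : {within `[a, b], continuous f}.
  apply: continuous_subspaceT => z; apply: differentiable_continuous.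
  by apply/derivable1_diffP; apply: ex_derive.
have [x0|x0|<-] := ltgtP 0 x; last by exists 0; rewrite // mulr0 subrr.
- have [c /andP[c0 cx] e] := MVT x0 (fun z _ => fdf z) (fc 0 x).
  exists c; last by rewrite e subr0.
  rewrite bnd_simp in c0; rewrite bnd_simp in cx.
  by rewrite !gtr0_norm // ltW.
- have [c /andP[c0 cx] e] := MVT x0 (fun z _ => fdf z) (fc x 0).
  rewrite bnd_simp in c0; rewrite bnd_simp in cx.
  exists c; last by apply: oppr_inj; rewrite opprB e sub0r mulrN.
  by rewrite !ltr0_norm // lerN2 ltW.
Qed.

Lemma norm_sin_le x : `|sin x| <= `|x|.
Proof.
have [c _] := MVT0 x (fun z => is_derive_sin z).
rewrite sin0 subr0 => ->; rewrite normrM ler_piMl //; exact: cos_max.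
Qed.

Lemma norm_cos_sub1_le x : `|cos x - 1| <= `|x|.
Proof.
have [c _] := MVT0 x (fun z => is_derive_cos z).
by rewrite cos0 => ->; rewrite normrM normrN ler_piMl //; exact: sin_max.
Qed.

Lemma norm_cos_sub1_le_sqr x : `|cos x - 1| <= x ^+ 2.
Proof.
have [c cx] := MVT0 x (fun z => is_derive_cos z).
rewrite cos0 => ->; rewrite normrM normrN -real_normK ?num_real // expr2 ler_wpM2r //.
exact: le_trans (norm_sin_le _) cx.
Qed.

Lemma norm_sin_sub_le_sqr x : `|sin x - x| <= x ^+ 2.
Proof.
have [c cx] := MVT0 x (fun z => is_derive_sin z).
rewrite sin0 subr0 => ->; rewrite -{2}[x]mul1r -mulrBl normrM.
rewrite -[leRHS]real_normK ?num_real // expr2 ler_wpM2r //.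
exact: le_trans (norm_cos_sub1_le _) cx.
Qed.

Lemma normc_real x : normc x%:C = `|x|.
Proof. by rewrite /Normc.normc /= expr0n addr0 sqrtr_sqr. Qed.

Lemma normc_i : normc 'i = 1.
Proof. by rewrite /Normc.normc /= expr0n add0r expr1n sqrtr1. Qed.

Lemma normc_ge0 z : 0 <= normc z.
Proof. by case: z => a b; exact: sqrtr_ge0. Qed.

Lemma normcD z w : normc (z + w) <= normc z + normc w.
Proof. exact: le_normcD. Qed.

Lemma normcNE z : normc (- z) = normc z.
Proof. exact: normcN. Qed.

Lemma normc_cis_sub x : normc (cis x - 1 - 'i * x%:C) <= 2 * x ^+ 2.
Proof.
have -> : cis x - 1 - 'i * x%:C = (cos x - 1)%:C + 'i * (sin x - x)%:C.
  by rewrite /cis; simpc.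
apply: (le_trans (normcD _ _));
  rewrite Normc.normcM normc_i mul1r !normc_real mulr2n mulrDl mul1r.
by rewrite lerD // ?norm_cos_sub1_le_sqr ?norm_sin_sub_le_sqr.
Qed.
End Cis.

(** The entrywise l1 norm is submultiplicative and equivalent to [opnorm], and it can be bounded one
    entry at a time. *)
Definition mxnorm (R : realType) (m n : nat) (A : 'M[R[i]]_(m, n)) : R :=
  \sum_i \sum_j Normc.normc (A i j).

Section Mxnorm.
Variable R : realType.
Local Notation normc := (@Normc.normc R).

Lemma mxnorm_ge0 m n (A : 'M[R[i]]_(m, n)) : 0 <= mxnorm A.
Proof. by do 2!apply: sumr_ge0 => ? _; exact: normc_ge0. Qed.

Lemma mxnorm_entry m n (A : 'M[R[i]]_(m, n)) i j : normc (A i j) <= mxnorm A.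
Proof.
rewrite /mxnorm (bigD1 i) //= (bigD1 j) //= -addrA lerDl addr_ge0 //.
  by apply: sumr_ge0 => ? _; exact: normc_ge0.
by do 2!apply: sumr_ge0 => ? _; exact: normc_ge0.
Qed.

Lemma mxnormD m n (A B : 'M[R[i]]_(m, n)) : mxnorm (A + B) <= mxnorm A + mxnorm B.
Proof.
rewrite /mxnorm -big_split ler_sum // => i _; rewrite -big_split ler_sum // => j _.
by rewrite mxE normcD.
Qed.

Lemma mxnormN m n (A : 'M[R[i]]_(m, n)) : mxnorm (- A) = mxnorm A.
Proof. by do 2!apply: eq_bigr => ? _; rewrite mxE normcNE. Qed.

Lemma mxnormB m n (A B : 'M[R[i]]_(m, n)) : mxnorm (A - B) <= mxnorm A + mxnorm B.
Proof. by rewrite -(mxnormN B) mxnormD. Qed.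

Lemma mxnorm_distC m n (A B : 'M[R[i]]_(m, n)) : mxnorm (A - B) = mxnorm (B - A).
Proof. by rewrite -mxnormN opprB. Qed.

Lemma mxnormZ m n a (A : 'M[R[i]]_(m, n)) : mxnorm (a *: A) = normc a * mxnorm A.
Proof.
rewrite /mxnorm mulr_sumr; apply: eq_bigr => i _; rewrite mulr_sumr;
  apply: eq_bigr => j _.
by rewrite mxE Normc.normcM.
Qed.

Lemma normc_sum (I : finType) (F : I -> R[i]) : normc (\sum_i F i) <= \sum_i normc (F i).
Proof.
elim/big_rec2 : _ => [|i y x _ h]; first by rewrite Normc.normc0.
by apply: le_trans (normcD _ _) _; rewrite lerD2l.
Qed.

Lemma mxnorm_sum (I : finType) m n (F : I -> 'M[R[i]]_(m, n)) : mxnorm (\sum_i F i) <=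
  \sum_i mxnorm (F i).
Proof.
elim/big_rec2 : _ => [|i y x _ h]; last by apply: le_trans (mxnormD _ _) _;
  rewrite lerD2l.
by rewrite /mxnorm !big1 // => i _; rewrite big1 // => j _; rewrite mxE Normc.normc0.
Qed.

Lemma mxnormM m n p (A : 'M[R[i]]_(m, n)) (B : 'M[R[i]]_(n, p)) :
  mxnorm (A *m B) <= mxnorm A * mxnorm B.
Proof.
rewrite {1 2}/mxnorm mulr_suml ler_sum // => i _.
apply: (@le_trans _ _ (\sum_j \sum_k normc (A i k) * normc (B k j))).
  apply: ler_sum => j _; rewrite mxE; apply: le_trans (normc_sum _) _.
  by apply: ler_sum => k _; rewrite Normc.normcM.
rewrite exchange_big mulr_suml ler_sum // => k _.
rewrite -mulr_sumr ler_wpM2l ?normc_ge0 //.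
rewrite /mxnorm [leRHS](bigD1 k) //= lerDl; by do 2!apply: sumr_ge0 => ? _;
  exact: normc_ge0.
Qed.

Lemma unitary_entry N (U : 'M[R[i]]_N) i j : U \is unitarymx -> normc (U i j) <= 1.
Proof.
move=> /unitarymxP /matrixP /(_ i i); rewrite !mxE eqxx => e.
have {}e : \sum_k (normc (U i k) ^+ 2) = 1.
  apply: (@complexI R); rewrite rmorph_sum; apply: etrans _ e.
  apply: eq_bigr => k _; rewrite !mxE -normCK rmorphXn normc_def.
  by case: (U i k).
have h : normc (U i j) ^+ 2 <= 1.
  by rewrite -e (bigD1 j) //= lerDl sumr_ge0 // => k _; rewrite exprn_ge0 // normc_ge0.
by rewrite -(@ler_pXn2r _ 2%N) ?expr1n // ?nnegrE // normc_ge0.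
Qed.

Lemma mxnorm_unitary N (U : 'M[R[i]]_N) : U \is unitarymx -> mxnorm U <= (N * N)%:R.
Proof.
move=> uU; rewrite /mxnorm natrM.
apply: (@le_trans _ _ (\sum_(i < N) \sum_(j < N) 1)).
  by do 2!apply: ler_sum => ? _; exact: unitary_entry.
by rewrite !sumr_const card_ord mulr_natr.
Qed.
End Mxnorm.

Lemma hermsymmxP (C : numClosedFieldType) N (A : 'M[C]_N) : (A \is hermsymmx) <->
  A^t* = A.
Proof.
split => [/is_hermitianmxP|h]; first by rewrite expr0 scale1r.
by apply/is_hermitianmxP; rewrite expr0 scale1r h.
Qed.

Section Evol.
Variables (R : realType) (N : nat).
Local Notation M := 'M[R[i]]_N.
Local Notation normc := (@Normc.normc R).
Implicit Types (H K J U : M) (s t : R).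

Lemma evol_unitary H t : H \is hermsymmx -> evol H t \is unitarymx.
Proof.
move=> /hermitian_udiag [P [x [uP ->]]]; rewrite (evol_udiag _ _ uP).
apply: (udiag_unitary uP) => k; exact: cisMJ.
Qed.

(* Both sides are compared entrywise in eigenbases of H and K, where the
   intertwiner only links equal eigenvalues. *)
Lemma evol_intertwine H K J t : H \is hermsymmx -> K \is hermsymmx ->
  H *m J = J *m K -> evol H t *m J = J *m evol K t.
Proof.
move=> /hermitian_udiag [P [x [uP ->]]] /hermitian_udiag [Q [y [uQ ->]]].
rewrite (evol_udiag _ _ uP) (evol_udiag _ _ uQ) /udiag => e.
set W := P *m J *m Q^t*.
have JE : J = P^t* *m W *m Q.
  by rewrite /W !mulmxA (unitarymxK uP) mul1mx -mulmxA (unitarymxK uQ) mulmx1.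
have {}e : diag_mx (\row_k (x k)%:C) *m W = W *m diag_mx (\row_k (y k)%:C).
  have := congr1 (fun Z => P *m Z *m Q^t*) e.
  rewrite {1}/W !mulmxA (unitarymxP uP) mul1mx => ->.
  by rewrite -!mulmxA (unitarymxP uQ) mulmx1.
clearbody W.
have {}e : diag_mx (\row_k cis (- (t * x k))) *m W =
  W *m diag_mx (\row_k cis (- (t * y k))).
  apply/matrixP => i j; have /matrixP/(_ i j) := e.
  rewrite !mul_diag_mx !mul_mx_diag !mxE => eij.
  have [->|W0] := eqVneq (W i j) 0; first by rewrite mulr0 mul0r.
  by rewrite mulrC in eij; rewrite (complexI (mulfI W0 eij)) mulrC.
move: e; move: (diag_mx (\row_k cis (- (t * x k)))) => D.
move: (diag_mx (\row_k cis (- (t * y k)))) => D' e.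
rewrite {}JE -!mulmxA (mulmxA P) (unitarymxP uP) mul1mx.
by rewrite (mulmxA Q) (unitarymxP uQ) mul1mx (mulmxA D) e !mulmxA.
Qed.

Lemma herm_conj H U : H \is hermsymmx -> U *m H *m U^t* \is hermsymmx.
Proof. by move=> /hermsymmxP hH; apply/hermsymmxP;
  rewrite !adj_mulmx trmxCK hH mulmxA. Qed.

Lemma evol_conj H U t : H \is hermsymmx -> U \is unitarymx ->
  evol (U *m H *m U^t*) t = U *m evol H t *m U^t*.
Proof.
move=> hH uU; have := @evol_intertwine (U *m H *m U^t*) H U t.
rewrite -[U *m H *m U^t* *m U]mulmxA (unitarymxK uU) mulmx1.
move=> /(_ (herm_conj _ hH) hH erefl) <-.
by rewrite -[RHS]mulmxA (unitarymxP uU) mulmx1.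
Qed.

Lemma evolZ H c t : evol (c%:C *: H) t = evol H (c * t).
Proof.
apply: (congr1 (@expmx R N)); apply: etrans (scalerA _ _ _) _.
by apply: (congr1 ( *:%R^~ H)); rewrite rmorphM /=; ring.
Qed.

Lemma evol0 H : H \is hermsymmx -> evol H 0 = 1%:M.
Proof.
move=> /hermitian_udiag [P [x [uP ->]]]; rewrite (evol_udiag _ _ uP) -(udiag_cst uP).
apply: eq_udiag => k.
by rewrite mul0r oppr0 cis0.
Qed.

Lemma evolX H s m : H \is hermsymmx -> evol H s ^+ m = evol H (m%:R * s).
Proof.
move=> /hermitian_udiag [P [x [uP ->]]]; rewrite !(evol_udiag _ _ uP) (udiagX uP).
by apply: eq_udiag => k; rewrite cisX; congr cis; ring.
Qed.

Lemma evol_adj H t : H \is hermsymmx -> (evol H t)^t* = evol (- H) t.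
Proof.
move=> /hermitian_udiag [P [x [uP ->]]].
have -> : - udiag P (fun k => (x k)%:C) = udiag P (fun k => (- x k)%:C).
  rewrite -scaleN1r; apply: etrans (udiagZ _ _ _) _; apply: eq_udiag => k.
  by rewrite mulN1r rmorphN.
apply: etrans (congr1 (fun Z : M => Z^t*) (evol_udiag x t uP)) _.
apply: etrans (udiag_adj _ _) _.
apply: etrans _ (esym (evol_udiag (fun k => - x k) t uP));
  apply: eq_udiag => k; by rewrite cisJ mulrN.
Qed.

Lemma evol_scalar (c : R) t : evol (c%:C%:M : M) t = (cis (- (t * c)))%:M.
Proof.
have u1 : (1%:M : M) \is unitarymx by apply/unitarymxP; rewrite trmx1 map_mx1 mulmx1.
by rewrite -(udiag_cst u1) (evol_udiag _ _ u1) (udiag_cst u1).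
Qed.

Let B : R := (N * N)%:R.

Lemma mxnorm_delta (i j : 'I_N) : mxnorm (delta_mx i j : M) <= B.
Proof.
rewrite /B natrM /mxnorm; apply: (@le_trans _ _ (\sum_(i < N) \sum_(j < N) 1)).
  do 2!apply: ler_sum => ? _; rewrite mxE;
    case: (_ && _); by rewrite ?Normc.normc1 ?Normc.normc0.
by rewrite !sumr_const card_ord mulr_natr.
Qed.

Lemma mxnorm_udiag (P : M) d : P \is unitarymx ->
  mxnorm (udiag P d) <= B ^+ 3 * \sum_k normc (d k).
Proof.
move=> uP; rewrite udiagE mulr_sumr; apply: (le_trans (mxnorm_sum _)).
apply: ler_sum => k _; rewrite mxnormZ mulrC ler_wpM2r ?normc_ge0 //.
apply: (le_trans (mxnormM _ _)); rewrite exprSr.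
apply: ler_pM; rewrite ?mxnorm_ge0 ?(mxnorm_unitary uP) //.
apply: (le_trans (mxnormM _ _)); rewrite expr2.
by apply: ler_pM; [exact: mxnorm_ge0|exact: mxnorm_ge0|apply: mxnorm_unitary;
  rewrite trmxC_unitary; exact: uP|exact: mxnorm_delta].
Qed.

(** The constant is uniform in K because [simulated_commutator] applies the estimate to a
    Hamiltonian that itself varies with s. *)
Lemma evol_expansion : exists2 c, 0 <= c & forall K s, K \is hermsymmx ->
  mxnorm (evol K s - (1%:M - ('i * s%:C) *: K)) <= c * mxnorm K ^+ 2 * s ^+ 2.
Proof.
have B0 : 0 <= B by [].
exists (B ^+ 3 * (N%:R * (2 * B ^+ 4))).
  by rewrite !mulr_ge0 // exprn_ge0.
move=> _ s /hermitian_udiag [P [x [uP ->]]].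
set K := udiag _ _.
(* An eigenvalue is a diagonal entry of K conjugated by P, and each of the two unitaries costs a
   factor B. *)
have xK k : `|x k| <= B ^+ 2 * mxnorm K.
  have e : P *m K *m P^t* = diag_mx (\row_k (x k)%:C).
    by rewrite /K /udiag !mulmxA (unitarymxP uP) mul1mx -mulmxA (unitarymxP uP) mulmx1.
  rewrite -normc_real; have -> : (x k)%:C = (P *m K *m P^t*) k k by rewrite e !mxE eqxx.
  apply: le_trans (mxnorm_entry _ _ _) _; apply: le_trans (mxnormM _ _) _.
  rewrite expr2 mulrAC; apply: ler_pM; [exact: mxnorm_ge0|exact: mxnorm_ge0| |].
    by apply: le_trans (mxnormM _ _) _; apply: (ler_wpM2r (mxnorm_ge0 _));
      exact: mxnorm_unitary.
  by apply: mxnorm_unitary; rewrite trmxC_unitary; exact: uP.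
have -> : evol K s - (1%:M - ('i * s%:C) *: K) =
    udiag P (fun k => cis (- (s * x k)) - 1 - 'i * (- (s * x k))%:C).
  rewrite /K (evol_udiag _ _ uP) -(udiag_cst uP 1).
  rewrite (_ : ('i * s%:C) *: _ = udiag P (fun k => ('i * s%:C) * (x k)%:C));
    last exact: udiagZ.
  rewrite -[X in _ - X]opprK opprB opprK.
  rewrite (_ : - udiag P (fun=> 1) = udiag P (fun=> -1)); last first.
    by rewrite -scaleN1r; apply: etrans (udiagZ _ _ _) _; apply: eq_udiag => k;
      rewrite mulr1.
  apply: etrans (congr1 (+%R (udiag P (fun k => cis (- (s * x k))))) (udiagD _ _ _)) _.
  apply: etrans (udiagD _ _ _) _; apply: eq_udiag => k.
  by rewrite rmorphN rmorphM /=; ring.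
apply: (le_trans (mxnorm_udiag _ uP));
  rewrite [leRHS](_ : _ = B ^+ 3 * (N%:R * (2 * (B ^+ 4 * (mxnorm K ^+ 2 * s ^+ 2)))));
    last by ring.
rewrite ler_wpM2l ?exprn_ge0 //.
apply: (@le_trans _ _ (\sum_(k < N) 2 * (B ^+ 4 * (mxnorm K ^+ 2 * s ^+ 2)))); last first.
  by rewrite sumr_const card_ord -[leLHS]mulr_natl.
apply: ler_sum => k _; apply: le_trans (normc_cis_sub _) _; rewrite ler_wpM2l //.
rewrite sqrrN exprMn mulrC mulrA ler_wpM2r ?sqr_ge0 //.
rewrite -[x k ^+ 2]real_normK ?num_real //.
have -> : B ^+ 4 * mxnorm K ^+ 2 = (B ^+ 2 * mxnorm K) ^+ 2 by ring.
by rewrite ler_pXn2r // ?nnegrE // mulr_ge0 ?mxnorm_ge0 // exprn_ge0.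
Qed.
End Evol.

(** * The cone of simulated Hamiltonians *)

Section BigO.
Variables (R : realType) (N : nat).
Local Notation M := 'M[R[i]]_N.
Implicit Types (f g : R -> M).

(** The range 0 < s <= 1 makes a higher order imply a lower one; [simulated_chernoff] evaluates only
    at s = t / m in this range. *)
Definition bigO k f := exists c : R, forall s, 0 < s -> s <= 1 ->
  mxnorm (f s) <= c * s ^+ k.

Lemma bigO_ge0 k f : bigO k f ->
  exists2 c : R, 0 <= c & forall s, 0 < s -> s <= 1 -> mxnorm (f s) <= c * s ^+ k.
Proof.
move=> [c h]; exists c => //; have := h 1 ltr01 (lexx _).
by rewrite expr1n mulr1; apply: le_trans; exact: mxnorm_ge0.
Qed.

Lemma eq_bigO k f g : (forall s, 0 < s -> f s = g s) -> bigO k f -> bigO k g.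
Proof. by move=> fg [c h]; exists c => s s0 s1; rewrite -(fg _ s0); exact: h. Qed.

Lemma bigOD k f g : bigO k f -> bigO k g -> bigO k (fun s => f s + g s).
Proof.
move=> [c h] [c' h']; exists (c + c') => s s0 s1.
by apply: le_trans (mxnormD _ _) _; rewrite mulrDl lerD // ?h ?h'.
Qed.

Lemma bigON k f : bigO k f -> bigO k (fun s => - f s).
Proof. by move=> [c h]; exists c => s s0 s1; rewrite mxnormN; exact: h. Qed.

Lemma bigOM k l f g : bigO k f -> bigO l g -> bigO (k + l) (fun s => f s *m g s).
Proof.
move=> [c h] [c' h']; exists (c * c') => s s0 s1.
apply: le_trans (mxnormM _ _) _; rewrite exprD.
have -> : c * c' * (s ^+ k * s ^+ l) = (c * s ^+ k) * (c' * s ^+ l) by ring.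
by apply: ler_pM; [exact: mxnorm_ge0|exact: mxnorm_ge0|exact: h|exact: h'].
Qed.

Lemma bigO_le k l f : (l <= k)%N -> bigO k f -> bigO l f.
Proof.
move=> lk /bigO_ge0 [c c0 h]; exists c => s s0 s1; apply: le_trans (h _ s0 s1) _.
by rewrite ler_wpM2l //; apply: ler_wiXn2l => //; exact: ltW.
Qed.

Lemma bigO_cst A : bigO 0 (fun=> A).
Proof. by exists (mxnorm A) => s _ _; rewrite expr0 mulr1. Qed.

Lemma bigO_iscale A : bigO 1 (fun s => ('i * s%:C) *: A).
Proof.
exists (mxnorm A) => s s0 _.
by rewrite mxnormZ Normc.normcM normc_i normc_real mul1r expr1 gtr0_norm // mulrC.
Qed.

Lemma bigO_evol K : K \is hermsymmx ->
  bigO 2 (fun s => evol K s - (1%:M - ('i * s%:C) *: K)).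
Proof.
by move=> hK; have [c _ h] := evol_expansion R N; exists (c * mxnorm K ^+ 2) => s _ _;
  exact: h.
Qed.
End BigO.

Section Simulation.
Variables (R : realType) (N : nat).
Local Notation M := 'M[R[i]]_N.
Variable circ : M -> Prop.
Hypothesis circ1 : circ 1%:M.
Hypothesis circM : forall A B, circ A -> circ B -> circ (A *m B).
Hypothesis circU : forall A, circ A -> A \is unitarymx.

Definition approximable (A : M) := forall e : R, 0 < e ->
  exists2 B, circ B & mxnorm (B - A) < e.

(** N^2 bounds the norm of a unitary; the added 1 covers the distance from a limit to an
    approximating element of [circ]. *)
Let b : R := (N * N)%:R + 1.

Lemma approximable_circ A : circ A -> approximable A.
Proof.
move=> cA e e0; exists A; first exact: cA.
by rewrite subrr -(scale0r 0) mxnormZ Normc.normc0 mul0r.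
Qed.

Lemma approximable_bound A : approximable A -> mxnorm A <= b.
Proof.
move=> /(_ 1 ltr01) [B cB h].
rewrite -[A](subrK B) addrC; apply: le_trans (mxnormD _ _) _.
by apply: lerD; [apply: mxnorm_unitary; exact: circU|rewrite mxnorm_distC ltW].
Qed.

Lemma approximable_closed A :
  (forall e : R, 0 < e -> exists2 B, approximable B & mxnorm (B - A) < e) ->
    approximable A.
Proof.
move=> h e e0; have e2 : 0 < e / 2 by rewrite divr_gt0.
have [B /(_ _ e2) [D cD hD] hB] := h _ e2.
exists D; first exact: cD.
rewrite -[D](subrK B) -addrA; apply: le_lt_trans (mxnormD _ _) _; lra.
Qed.

Lemma bound_gt0 : 0 < b. Proof. by rewrite ltr_wpDl. Qed.

Lemma approximableM A B : approximable A -> approximable B -> approximable (A *m B).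
Proof.
move=> aA aB e e0.
have e2 : 0 < e / (b * 2) by rewrite divr_gt0 // mulr_gt0 // bound_gt0.
have [A' cA hA] := aA _ e2; have [B' cB hB] := aB _ e2.
exists (A' *m B'); first exact: circM.
have -> : A' *m B' - A *m B = A' *m (B' - B) + (A' - A) *m B.
  by rewrite mulmxBr mulmxBl addrA subrK.
apply: le_lt_trans (mxnormD _ _) _.
have h1 : mxnorm (A' *m (B' - B)) <= b * mxnorm (B' - B).
  apply: le_trans (mxnormM _ _) _; apply: (ler_wpM2r (mxnorm_ge0 _)).
  exact: approximable_bound (approximable_circ cA).
have h2 : mxnorm ((A' - A) *m B) <= b * mxnorm (A' - A).
  apply: le_trans (mxnormM _ _) _; rewrite mulrC; apply: (ler_wpM2r (mxnorm_ge0 _)).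
  exact: approximable_bound.
have h3 : b * (e / (b * 2)) = e / 2 by field; rewrite gt_eqF // bound_gt0.
rewrite -(ltr_pM2l bound_gt0) h3 in hA; rewrite -(ltr_pM2l bound_gt0) h3 in hB.
lra.
Qed.

Lemma approximableX A m : approximable A -> approximable (A ^+ m).
Proof.
move=> aA; elim: m => [|m IH]; first exact: approximable_circ.
by rewrite exprS; apply: approximableM.
Qed.

(** The powers of both matrices stay below b, so each of the m telescoping terms has the same bound
    and the total grows only linearly in m. *)
Lemma mxnorm_subX A B m : approximable A -> (forall k, mxnorm (B ^+ k) <= b) ->
  mxnorm (A ^+ m - B ^+ m) <= m%:R * (b ^+ 2 * mxnorm (A - B)).
Proof.
move=> aA hB.
have -> : A ^+ m - B ^+ m = \sum_(k < m) A ^+ (m - k.+1) *m (A - B) *m B ^+ k.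
  elim: m => [|m IH]; first by rewrite subrr big_ord0.
  rewrite big_ord_recl subn1 expr0 mulmx1 /=.
  under eq_bigr => k _ do rewrite /bump /= add1n subSS exprSr mulmxE mulrA -mulmxE.
  have -> : \sum_(k < m) A ^+ (m - k.+1) *m (A - B) *m B ^+ k *m B =
    (A ^+ m - B ^+ m) *m B.
    by rewrite IH mulmx_suml.
  by rewrite mulmxBr mulmxBl !exprSr !mulmxE addrA subrK.
apply: le_trans (mxnorm_sum _) _.
apply: (@le_trans _ _ (\sum_(k < m) b ^+ 2 * mxnorm (A - B))); last first.
  by rewrite sumr_const card_ord -[leLHS]mulr_natl.
apply: ler_sum => k _; apply: le_trans (mxnormM _ _) _.
have -> : b ^+ 2 * mxnorm (A - B) = b * mxnorm (A - B) * b by ring.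
apply: ler_pM; [exact: mxnorm_ge0|exact: mxnorm_ge0| |exact: hB].
apply: le_trans (mxnormM _ _) _; apply: (ler_wpM2r (mxnorm_ge0 _)).
by apply: approximable_bound; exact: approximableX.
Qed.

Definition simulated (K : M) := K \is hermsymmx /\ forall t : R, 0 <= t ->
  approximable (evol K t).

(* By telescoping, the m-th powers of f (t / m) and of the evolution for time t / m
   differ by O(1 / m). *)
Lemma simulated_chernoff (f : R -> M) K : K \is hermsymmx ->
  (forall s, 0 < s -> s <= 1 -> approximable (f s)) ->
  bigO 2 (fun s => f s - (1%:M - ('i * s%:C) *: K)) -> simulated K.
Proof.
move=> hK fG fO; split=> [|t t0]; first exact: hK.
have : bigO 2 (fun s => f s - evol K s).
  apply: eq_bigO (bigOD fO (bigON (bigO_evol hK))) => s _.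
  by rewrite [- (evol K s - _)]opprB addrA subrK.
move=> /bigO_ge0 [c c0 fE].
have [t0'|tpos] := leP t 0.
  have -> : t = 0 by apply/le_anti; rewrite t0 t0'.
  by rewrite (evol0 hK); exact: approximable_circ.
apply: approximable_closed => e e0.
(* Any m above q gives both t / m <= 1 and an error b^2 c t^2 / m below e. *)
pose q := (b ^+ 2 * c * t ^+ 2) / e + t.
have q0 : 0 < q.
  by rewrite ltr_wpDl // divr_ge0 ?(ltW e0) // !mulr_ge0 ?exprn_ge0 // ltW ?bound_gt0.
have [m qm] : exists m : nat, q < m%:R by exists (Num.bound q);
  exact: archi_boundP (ltW q0).
have m0 : 0 < m%:R :> R by exact: lt_trans qm.
have tm : t < m%:R.
  apply: le_lt_trans qm; rewrite lerDr divr_ge0 ?(ltW e0) // !mulr_ge0 ?exprn_ge0 //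
    ltW ?bound_gt0 //.
have s0 : 0 < t / m%:R by rewrite divr_gt0.
have s1 : t / m%:R <= 1 by rewrite ler_pdivrMr // mul1r ltW.
have aF := fG _ s0 s1.
exists (f (t / m%:R) ^+ m); first exact: approximableX.
have -> : evol K t = evol K (t / m%:R) ^+ m.
  by rewrite (evolX _ _ hK); congr evol; field; rewrite gt_eqF.
have EB k : mxnorm (evol K (t / m%:R) ^+ k) <= b.
  rewrite (evolX _ _ hK).
  apply: le_trans (mxnorm_unitary (evol_unitary _ hK)) _.
  by rewrite lerDl.
apply: (le_lt_trans (mxnorm_subX m aF EB)).
apply: (@le_lt_trans _ _ (m%:R * (b ^+ 2 * (c * (t / m%:R) ^+ 2)))).
  rewrite (ler_pM2l m0) ler_wpM2l ?exprn_ge0 ?(ltW bound_gt0) //; exact: fE.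
have -> : m%:R * (b ^+ 2 * (c * (t / m%:R) ^+ 2)) = (b ^+ 2 * c * t ^+ 2) / m%:R.
  by field; rewrite gt_eqF.
rewrite ltr_pdivrMr // -ltr_pdivrMl // mulrC.
by apply: le_lt_trans qm; rewrite lerDl ltW.
Qed.

(** The first-order Trotter formula: the product of the two evolutions agrees with 1 - is(K + L) up
    to O(s^2). *)
Lemma simulatedD K L : simulated K -> simulated L -> simulated (K + L).
Proof.
move=> [hK sK] [hL sL].
apply: (@simulated_chernoff (fun s => evol K s *m evol L s)).
- by apply/hermsymmxP; rewrite linearD map_mxD; move/hermsymmxP: hK => ->;
  move/hermsymmxP: hL => ->.
- by move=> s s0 _; apply: approximableM; [apply: sK|apply: sL]; exact: ltW.
have OL := bigO_evol hL; have OK := bigO_evol hK.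
have O1 : bigO 0 (fun s => evol L s).
  apply: eq_bigO (bigOD (bigO_le (leq0n 2) OL) (bigOD (bigO_cst 1%:M)
    (bigON (bigO_le (leq0n 1) (bigO_iscale L))))) => s _.
  by rewrite subrK.
have O2 : bigO 0 (fun s => 1%:M - ('i * s%:C) *: K).
  exact: bigOD (bigO_cst 1%:M) (bigON (bigO_le (leq0n 1) (bigO_iscale K))).
(* With x = isK and y = isL, the error is the remainder of K times the evolution of L, plus (1 - x)
   times the remainder of L, plus xy; each is of order 2. *)
apply: eq_bigO (bigOD (bigOM OK O1)
  (bigOD (bigOM O2 OL) (bigOM (bigO_iscale K) (bigO_iscale L)))) => s _.
set x := ('i * s%:C) *: K; set y := ('i * s%:C) *: L.
rewrite [('i * s%:C) *: (K + L)]scalerDr -/x -/y !(mulmxBl, mulmxBr, mulmx1, mul1mx).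
move: x y (1%:M : M) (evol L s) (x *m y) (x *m evol L s) (evol K s *m evol L s) => x y
  o B w p a.
by apply/matrixP => k l; rewrite !mxE; ring.
Qed.

Lemma simulatedZ c K : 0 <= c -> simulated K -> simulated (c%:C *: K).
Proof.
move=> c0 [hK sK]; split=> [|t t0]; last by rewrite evolZ; apply: sK; exact: mulr_ge0.
apply/hermsymmxP; rewrite linearZ map_mxZ; move/hermsymmxP: hK => ->.
by apply: (congr1 ( *:%R^~ K)); exact: conjc_real.
Qed.

Lemma simulated_conj U K : U \is unitarymx -> approximable U -> approximable (U^t*) ->
  simulated K ->
  simulated (U *m K *m U^t*).
Proof.
move=> uU aU aU' [hK sK]; split=> [|t t0]; first exact: herm_conj.
by rewrite (evol_conj _ hK uU); apply: approximableM aU'; apply: approximableM aU _;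
  exact: sK.
Qed.

(* The conjugates of L by the evolution of K move L in the direction of the
   commutator, and difference quotients stay in the cone. *)
Lemma simulated_commutator K L : simulated K -> simulated (- K) -> simulated L ->
  simulated (- L) ->
  simulated (- 'i *: (K *m L - L *m K)).
Proof.
move=> sK sNK sL sNL.
set C := - 'i *: _.
(* A positive multiple of a conjugate of L plus -L, hence in the cone. The adjoint evolution is
   available because -K is simulated. *)
pose W s := (s^-1)%:C *: (evol K s *m L *m (evol K s)^t* - L).
pose D s := evol K s *m L *m (evol K s)^t* - L - s%:C *: C.
have [hK _] := sK; have [hNK _] := sNK; have [hL _] := sL.
have sW s : 0 < s -> simulated (W s).
  move=> s0; apply: simulatedZ; first by rewrite invr_ge0 ltW.
  apply: simulatedD sNL; apply: simulated_conj sL; first exact: evol_unitary.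
    by apply: sK.2; exact: ltW.
  by rewrite (evol_adj _ hK); apply: sNK.2; exact: ltW.
have OD : bigO 2 D.
  have O1 := bigO_evol hK; have O2 := bigO_evol hNK.
  have O3 : bigO 0 (fun s => evol (- K) s).
    apply: eq_bigO (bigOD (bigO_le (leq0n 2) O2) (bigOD (bigO_cst 1%:M)
      (bigON (bigO_le (leq0n 1) (bigO_iscale (- K)))))) => s _.
    by rewrite subrK.
  have O4 : bigO 0 (fun s => 1%:M - ('i * s%:C) *: K).
    exact: bigOD (bigO_cst 1%:M) (bigON (bigO_le (leq0n 1) (bigO_iscale K))).
  have O5 := bigOM (bigO_iscale K) (bigOM (bigO_cst L) (bigO_iscale K)).
  apply: eq_bigO (bigOD (bigOM O1 (bigOM (bigO_cst L) O3))
    (bigOD (bigOM O4 (bigOM (bigO_cst L) O2)) (bigON O5))) => s _.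
  rewrite /D (evol_adj _ hK).
  have -> : s%:C *: C = L *m (('i * s%:C) *: K) - (('i * s%:C) *: K) *m L.
    rewrite -scalemxAr -scalemxAl -scalerBr /C scalerA.
    by rewrite -[L *m K - K *m L]opprB scalerN -scaleNr; congr (_ *: _); ring.
  have -> : ('i * s%:C) *: (- K) = - (('i * s%:C) *: K) by rewrite scalerN.
  set x := ('i * s%:C) *: K.
  rewrite !(opprK, mulmxDr, mulmxBl, mulmxBr, mulmx1, mul1mx, mulmxN).
  rewrite -!mulmxA.
  move: (x *m (L *m x)) => a; move: (x *m L) (L *m x) => d c.
  move: (evol K s *m _) => p; move: (x *m _) => q; move: (L *m evol _ _) => r.
 by apply/matrixP => k l; rewrite !mxE; ring.
have hC : C \is hermsymmx.
  apply/hermsymmxP; rewrite /C linearZ map_mxZ linearB map_mxB.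
  rewrite !adj_mulmx; move/hermsymmxP: hK => ->; move/hermsymmxP: hL => ->.
  rewrite -[L *m K - _]opprB scalerN -scaleNr; congr (_ *: _).
  by rewrite rmorphN opprK; simpc.
have i0 s : 0 < s -> (s^-1)%:C * s%:C = 1 :> R[i].
  by move=> s0; rewrite -rmorphM mulVf // gt_eqF.
have WE s : 0 < s -> W s = C + (s^-1)%:C *: D s.
  by move=> s0; rewrite /D [in RHS]scalerBr scalerA i0 // scale1r addrC subrK.
clearbody W D C.
(* The Hamiltonian [W s] depends on the time step, but its norm stays bounded as s tends to 0, so
   the second-order remainder is still O(s^2). *)
apply: (@simulated_chernoff (fun s => evol (W s) s)); first exact: hC.
  by move=> s s0 _; apply: (sW s s0).2; exact: ltW.
have [c c0 hc] := evol_expansion R N.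
have [c' c'0 hD] := bigO_ge0 OD.
have nW s : 0 < s -> s <= 1 -> mxnorm (W s) <= mxnorm C + c'.
  move=> s0 s1; rewrite WE //; apply: le_trans (mxnormD _ _) _;
    rewrite lerD2l mxnormZ normc_real.
  rewrite gtr0_norm ?invr_gt0 // mulrC ler_pdivrMr //; apply: le_trans (hD _ s0 s1) _.
  by rewrite ler_wpM2l // expr2 ler_piMl // ltW.
exists (c * (mxnorm C + c') ^+ 2 + c') => s s0 s1.
have -> : evol (W s) s - (1%:M - ('i * s%:C) *: C) =
   (evol (W s) s - (1%:M - ('i * s%:C) *: W s)) - 'i *: D s.
  have -> : 'i *: D s = ('i * s%:C) *: W s - ('i * s%:C) *: C.
    rewrite WE // scalerDr addrAC subrr add0r scalerA -mulrA [s%:C * _]mulrC.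
    by rewrite i0 // mulr1.
  move: (('i * s%:C) *: W s) (('i * s%:C) *: C) => x y;
    move: (evol _ _) (1%:M : M) => z o.
  by apply/matrixP => k l; rewrite !mxE; ring.
apply: le_trans (mxnormB _ _) _; rewrite mulrDl lerD //.
  apply: le_trans (hc _ _ (sW s s0).1) _.
  rewrite ler_wpM2r ?sqr_ge0 // ler_wpM2l //.
  rewrite ler_pXn2r ?nnegrE ?mxnorm_ge0 ?addr_ge0 ?mxnorm_ge0 //; exact: nW.
by rewrite mxnormZ normc_i mul1r; exact: hD.
Qed.
End Simulation.

(** * Tensors and maps acting on a single factor *)

Section GTensor.
Variables (C : numClosedFieldType) (n : nat) (d : 'I_n -> nat).
Local Notation fam := (forall j : 'I_n, 'M[C]_(d j)).
Implicit Types A B U : fam.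

(** Distributivity with an index type that varies with j: [fprod] carries the dependent functions to
    the form expected by [bigA_distr_big_dep]. *)
Lemma prod_sum_dffun (T_ : 'I_n -> finType) (F : forall j : 'I_n, T_ j -> C) :
  \prod_j \sum_(u : T_ j) F j u = \sum_(f : {dffun forall j, T_ j}) \prod_j F j (f j).
Proof.
pose P j := [ffun u : T_ j => F j u].
transitivity (\sum_(t : fprod T_) \prod_(j in 'I_n) P j (t j)).
  rewrite big_fprod /=.
  under eq_bigr => j _.
    rewrite (eq_bigr (fun u => P j u)); last by move=> u _; rewrite ffunE.
    rewrite (@big_tag _ _ _ _ T_ (fun j => P j) j) /=.
    over.
  by rewrite bigA_distr_big_dep.
rewrite (reindex (@fprod_of_dffun _ T_)); last exact/onW_bij/fprod_of_dffun_bij.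
apply: eq_bigr => x _; apply: eq_bigr => j _; rewrite ffunE.
by rewrite -[in RHS](fprod_of_dffunK x) ffunE.
Qed.

Lemma prod_sum_digit (F : forall j : 'I_n, 'I_(d j) -> C) :
  \prod_j \sum_(u < d j) F j u = \sum_(x < #|config d|) \prod_j F j (digit x j).
Proof.
rewrite (@prod_sum_dffun (fun j => 'I_(d j))).
by rewrite (reindex (@enum_val (config d) (mem predT))) //; exact/onW_bij/enum_val_bij.
Qed.

(** The formula of [tensor] over any closed field; over [R[i]] the two are convertible. *)
Definition gtensor A : 'M[C]_#|config d| :=
  \matrix_(x, y) \prod_j A j (digit x j) (digit y j).

Lemma eq_gtensor A B : (forall j, A j = B j) -> gtensor A = gtensor B.
Proof. by move=> AB; apply/matrixP => x y; rewrite !mxE; apply: eq_bigr => j _;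
  rewrite AB. Qed.

Lemma gtensorM A B : gtensor A *m gtensor B = gtensor (fun j => A j *m B j).
Proof.
apply/matrixP => x y; rewrite !mxE.
under [RHS]eq_bigr do rewrite mxE.
rewrite (prod_sum_digit (fun j u => A j (digit x j) u * B j u (digit y j))).
by apply: eq_bigr => z _; rewrite !mxE big_split.
Qed.

Lemma digit_inj (x y : 'I_#|config d|) : (forall j, digit x j = digit y j) -> x = y.
Proof. by move=> xy; apply: enum_val_inj; apply/ffunP => j; exact: xy. Qed.

Lemma gtensor_scalar (c : 'I_n -> C) : gtensor (fun j => (c j)%:M) = (\prod_j c j)%:M.
Proof.
apply/matrixP => x y; rewrite !mxE.
have [->|xy] := eqVneq x y.
  by rewrite mulr1n; apply: eq_bigr => j _; rewrite mxE eqxx mulr1n.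
have [j xyj] : exists j, digit x j != digit y j.
  by apply/existsP; apply: contraR xy => /existsPn h; apply/eqP/digit_inj => j;
    apply/eqP; have := h j; rewrite negbK.
by rewrite (bigD1 j) //= mxE (negbTE xyj) mulr0n mul0r.
Qed.

Lemma gtensor1 : gtensor (fun j => 1%:M) = 1%:M.
Proof. by rewrite gtensor_scalar big1. Qed.

Lemma gtensor_adj A : (gtensor A)^t* = gtensor (fun j => (A j)^t*).
Proof.
apply/matrixP => x y; rewrite !mxE rmorph_prod.
by apply: eq_bigr => j _; rewrite !mxE.
Qed.

Lemma gtensor_tr A : (gtensor A)^T = gtensor (fun j => (A j)^T).
Proof. by apply/matrixP => x y; rewrite !mxE; apply: eq_bigr => j _; rewrite !mxE. Qed.

Lemma mxtrace_gtensor A : \tr (gtensor A) = \prod_j \tr (A j).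
Proof.
rewrite /mxtrace (prod_sum_digit (fun j u => A j u u)).
by apply: eq_bigr => x _; rewrite mxE.
Qed.

Lemma gtensorZ (c : 'I_n -> C) A : gtensor (fun j => c j *: A j) = (\prod_j c j) *:
  gtensor A.
Proof.
by apply/matrixP => x y; rewrite !mxE -big_split; apply: eq_bigr => j _; rewrite mxE.
Qed.

Lemma gtensor_unitary U : (forall j, U j \is unitarymx) -> gtensor U \is unitarymx.
Proof.
move=> uU; apply/unitarymxP; rewrite gtensor_adj gtensorM -gtensor1.
by apply: eq_gtensor => j; apply/unitarymxP.
Qed.

Definition with_factor A (j : 'I_n) (X : 'M[C]_(d j)) : fam :=
  @dfwith 'I_n (fun k => 'M[C]_(d k)) A j X.

Lemma with_factor_in A j X : with_factor A X j = X.
Proof. exact: dfwith_in. Qed.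

Lemma with_factor_out A j X k : k != j -> @with_factor A j X k = A k.
Proof. by move=> kj; apply: dfwith_out; rewrite eq_sym. Qed.

Lemma gtensor_with A (j : 'I_n) (X : 'M[C]_(d j)) x y :
  gtensor (with_factor A X) x y =
    X (digit x j) (digit y j) * \prod_(k | k != j) A k (digit x k) (digit y k).
Proof.
rewrite mxE (bigD1 j) //= with_factor_in; congr (_ * _).
by apply: eq_bigr => k kj; rewrite with_factor_out.
Qed.

Lemma gtensor_with_id A (j : 'I_n) : gtensor (with_factor A (A j)) = gtensor A.
Proof. by apply/matrixP => x y; rewrite gtensor_with mxE [RHS](bigD1 j). Qed.

Lemma gtensor_withD A (j : 'I_n) (X Y : 'M[C]_(d j)) :
  gtensor (with_factor A (X + Y)) = gtensor (with_factor A X) + gtensor (with_factor A Y).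
Proof. by apply/matrixP => x y; rewrite [RHS]mxE !gtensor_with mxE mulrDl. Qed.

Lemma gtensor_withZ A (j : 'I_n) a (X : 'M[C]_(d j)) :
  gtensor (with_factor A (a *: X)) = a *: gtensor (with_factor A X).
Proof. by apply/matrixP => x y; rewrite [RHS]mxE !gtensor_with mxE mulrA. Qed.

Lemma gtensor_with2 A (j : 'I_n) (X Y : 'M[C]_(d j)) :
  gtensor (with_factor (with_factor A X) Y) = gtensor (with_factor A Y).
Proof.
apply/matrixP => x y; rewrite !gtensor_with; congr (_ * _).
by apply: eq_bigr => k kj; rewrite with_factor_out.
Qed.

Lemma gtensor_with_conj A (j : 'I_n) (U : 'M[C]_(d j)) :
  gtensor (with_factor (fun=> 1%:M) U) *m gtensor A *m
    (gtensor (with_factor (fun=> 1%:M) U))^t* =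
  gtensor (with_factor A (U *m A j *m U^t*)).
Proof.
rewrite gtensor_adj !gtensorM; apply: eq_gtensor => k.
have [->|kj] := eqVneq k j; first by rewrite !with_factor_in.
by rewrite !with_factor_out // trmx1 map_mx1 mul1mx mulmx1.
Qed.

Lemma with_factor_unitary (j : 'I_n) (U : 'M[C]_(d j)) : U \is unitarymx ->
  forall k, with_factor (fun k => 1%:M) U k \is unitarymx.
Proof.
move=> uU k; have [->|kj] := eqVneq k j; first by rewrite with_factor_in.
by rewrite with_factor_out //; apply/unitarymxP; rewrite trmx1 map_mx1 mulmx1.
Qed.
End GTensor.

Section SingleFactor.
Variables (C : numClosedFieldType) (d : nat).
Local Notation M := 'M[C]_d.
Implicit Types (X : M) (k l : 'I_d).

Definition flip k : M := diag_mx (\row_l (-1) ^+ (l == k)).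

Lemma flip_conjE k X a b : (flip k *m X *m (flip k)^t*) a b =
  (-1) ^+ (a == k) * (-1) ^+ (b == k) * X a b.
Proof.
rewrite /flip tr_diag_mx map_diag_mx mul_mx_diag mul_diag_mx !mxE.
by rewrite rmorphXn rmorphN1 mulrAC.
Qed.

Lemma flip_unitary k : flip k \is unitarymx.
Proof.
apply/unitarymxP; rewrite /flip tr_diag_mx map_diag_mx mulmx_diag.
rewrite -diag_const_mx; congr diag_mx; apply/rowP => l; rewrite !mxE.
by rewrite rmorphXn rmorphN1 -expr2 sqrr_sign.
Qed.

Lemma perm_conjE (s : 'S_d) X a b :
  (perm_mx s *m X *m (perm_mx s)^t*) a b = X (s a) (s b).
Proof.
by rewrite tr_perm_mx map_perm_mx -row_permE -col_permE !mxE.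
Qed.

Lemma perm_unitary (s : 'S_d) : perm_mx s \is @unitarymx C d d.
Proof. by apply/unitarymxP; rewrite tr_perm_mx map_perm_mx -perm_mxM mulgV perm_mx1. Qed.

(** An unnormalised average over sign changes: each k cancels the off-diagonal entries of row and
    column k and doubles all others. The identity map remains one of the summands. *)
Definition dephase (r : seq 'I_d) X : M :=
  foldr (fun k Y => Y + flip k *m Y *m (flip k)^t*) X r.

Lemma dephaseE r X a b : dephase r X a b =
  X a b * \prod_(k <- r) (1 + (-1) ^+ (a == k) * (-1) ^+ (b == k)).
Proof.
elim: r => [|k r IH]; first by rewrite big_nil mulr1.
by rewrite big_cons [LHS]mxE flip_conjE IH; ring.
Qed.

Lemma dephase_enum X : dephase (enum 'I_d) X = 2 ^+ d *: diag_mx (\row_k X k k).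
Proof.
apply/matrixP => a b; rewrite dephaseE !mxE; have [->|ab] := eqVneq a b.
  rewrite mulr1n mulrC; congr (_ * _).
  under eq_bigr do rewrite -expr2 sqrr_sign.
  by rewrite big_enum /= prodr_const card_ord.
rewrite mulr0n mulr0 big_enum /= (bigD1 a) //= eqxx.
by rewrite [b == a]eq_sym (negbTE ab) expr1 expr0 mulr1 subrr mul0r mulr0.
Qed.

Definition symmetrize X : M := \sum_(s : 'S_d) perm_mx s *m X *m (perm_mx s)^t*.

(** Dephasing followed by permuting is depolarising. Dephasing contributes 2^d, and d!/d of the
    permutations carry a given level to a given level. *)
Lemma symmetrize_dephase X : (0 < d)%N ->
  symmetrize (dephase (enum 'I_d) X) = (2 ^+ d * d`!%:R / d%:R * \tr X)%:M.
Proof.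
move=> d0; rewrite dephase_enum.
pose v a := \sum_(s : 'S_d) X (s a) (s a).
have E a b : symmetrize (2 ^+ d *: diag_mx (\row_k X k k)) a b =
  (2 ^+ d * v a) *+ (a == b).
  rewrite summxE /v mulr_sumr -sumrMnl; apply: eq_bigr => s _.
  by rewrite perm_conjE !mxE (inj_eq perm_inj) mulrnAr.
have vE a b : v a = v b.
  rewrite /v (reindex_inj (mulgI (tperm a b))); apply: eq_bigr => s _.
  by rewrite permM tpermL.
have sv : \sum_a v a = d`!%:R * \tr X.
  rewrite /v exchange_big (eq_bigr (fun=> \tr X)); last first.
    by move=> s _; rewrite /mxtrace [RHS](reindex_inj (@perm_inj _ s)).
  by rewrite sumr_const card_Sn mulr_natl.
apply/matrixP => a b; rewrite E mxE; congr (_ *+ _).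
have : \sum_k v k = d%:R * v a.
  by rewrite (eq_bigr (fun=> v a)) ?sumr_const ?card_ord ?mulr_natl // => k _; exact: vE.
rewrite sv => e; have d0' : d%:R != 0 :> C by rewrite pnatr_eq0 -lt0n.
apply: (mulfI d0'); rewrite mulrCA -e; field. exact: d0'.
Qed.

Definition twolevelZ k l : M := delta_mx k k - delta_mx l l.

(** A diagonal matrix minus its image under the swap of k and l retains only the difference of its
    two entries there. This is the first map of the form X |-> tr(AX)B, from which the others are
    built. *)
Lemma twolevelZ_map k l X : k != l ->
  diag_mx (\row_a X a a) - perm_mx (tperm k l) *m diag_mx (\row_a X a a) *m
    (perm_mx (tperm k l))^t* =
  \tr (twolevelZ k l *m X) *: twolevelZ k l.
Proof.
move=> kl.
have -> : \tr (twolevelZ k l *m X) = X k k - X l l.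
  have tr1 m : \tr (delta_mx m m *m X) = X m m.
    rewrite /mxtrace (bigD1 m) //= big1 ?addr0.
      rewrite mxE (bigD1 m) //= big1 ?addr0 ?mxE ?eqxx ?mul1r //.
      by move=> a /negbTE am; rewrite mxE am andbF mul0r.
    move=> a /negbTE am; rewrite mxE big1 // => b _.
    by rewrite mxE am mul0r.
  by rewrite mulmxBl linearB /= !tr1.
apply/matrixP => a b; rewrite [LHS]mxE [Z in _ + Z]mxE perm_conjE !mxE (inj_eq perm_inj).
have [<-|ab] := eqVneq a b; last first.
  have h m : (a == m) && (b == m) = false.
    by apply/negbTE/negP => /andP[/eqP am /eqP bm]; rewrite am bm eqxx in ab.
  by rewrite !h !mulr0n; ring.
rewrite !mulr1n !andbb; have [->|ak] := eqVneq a k.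
  by rewrite tpermL (negbTE kl) mulr1n mulr0n; ring.
have [al|al] := eqVneq a l.
  by rewrite al tpermR mulr1n mulr0n; ring.
by rewrite tpermD 1?eq_sym // mulr0n; ring.
Qed.

(* Every traceless diagonal matrix is a combination of the differences of two
   diagonal units, which are all permutation conjugates of one another. *)
Lemma traceless_herm_span k l X : k != l -> X \is hermsymmx -> \tr X = 0 ->
  exists (r : 'I_d -> C) (U : 'I_d -> M),
    [/\ forall m, r m \is Num.real, forall m, U m \is unitarymx &
        X = \sum_m r m *: (U m *m twolevelZ k l *m (U m)^t*)].
Proof.
move=> kl /hermitian_udiagC [P [x [uP rx ->]]] tr0.
(* [s m] carries m to k and k to l, so it conjugates [twolevelZ k l] into [twolevelZ m k]. As the
   eigenvalues sum to 0, the one at k is determined by the others, and the index m = k gets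
   coefficient 0. *)
pose s m : 'S_d := (tperm k m * tperm m l)%g.
exists (fun m => if m == k then 0 else x m), (fun m => P^t* *m perm_mx (s m)); split.
- by move=> m; case: ifP => // _; exact: real0.
- by move=> m; apply: mul_unitarymx; rewrite ?trmxC_unitary ?perm_unitary.
have sx : \sum_m x m = 0.
  apply: etrans _ tr0; rewrite /udiag mxtrace_mulC mulmxA (unitarymxP uP) mul1mx.
  by rewrite mxtrace_diag; apply: eq_bigr => m _; rewrite mxE.
rewrite /udiag.
have -> : diag_mx (\row_m x m) = \sum_m (if m == k then 0 else x m) *: twolevelZ m k.
  have -> : diag_mx (\row_m x m) = \sum_m x m *: delta_mx m m.
    by rewrite diag_mx_sum_delta; apply: eq_bigr => m _; rewrite mxE.
  rewrite [RHS](eq_bigr (fun m => x m *: delta_mx m m - x m *: delta_mx k k)); last first.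
    move=> m _; rewrite /twolevelZ; case: ifP => [/eqP ->|_]; last by rewrite scalerBr.
    by rewrite scale0r subrr.
  by rewrite sumrB -scaler_suml sx scale0r subr0.
rewrite mulmx_sumr mulmx_suml; apply: eq_bigr => m _.
rewrite -scalemxAr -scalemxAl; case: eqVneq => [->|mk]; first by rewrite !scale0r.
congr (_ *: _).
have -> : twolevelZ m k = perm_mx (s m) *m twolevelZ k l *m (perm_mx (s m))^t*.
  have sm : s m m = k by rewrite permM tpermR tpermD // eq_sym.
  have sk : s m k = l by rewrite permM tpermL tpermL.
  have hk w : (s m w == k) = (w == m) by rewrite -(inj_eq (@perm_inj _ (s m)) w m) sm.
  have hl w : (s m w == l) = (w == k) by rewrite -(inj_eq (@perm_inj _ (s m)) w k) sk.
  by apply/matrixP => u v; rewrite perm_conjE !mxE !hk !hl.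
by rewrite adj_mulmx trmxCK !mulmxA.
Qed.
End SingleFactor.

Lemma mxtrace_herm_real (C : numClosedFieldType) N (A B : 'M[C]_N) :
  A \is hermsymmx -> B \is hermsymmx -> \tr (A *m B) \is Num.real.
Proof.
move=> /hermsymmxP hA /hermsymmxP hB; apply/CrealP.
transitivity (\tr ((A *m B)^t*)); first by rewrite trace_map_mx mxtrace_tr.
by rewrite adj_mulmx hA hB mxtrace_mulC.
Qed.

(** * Cones invariant under local unitaries *)

Section LocalCone.
Variables (C : numClosedFieldType) (n : nat) (d : 'I_n -> nat).
Local Notation fam := (forall j : 'I_n, 'M[C]_(d j)).
Local Notation op := 'M[C]_#|config d|.
Hypothesis d0 : forall j, (0 < d j)%N.

(* Satisfied by the simulated Hamiltonians; closure under negation is derived in coneN. *)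
Record local_cone (L : op -> Prop) : Prop := LocalCone {
  cone_herm : forall K, L K -> K \is hermsymmx;
  coneD : forall K K', L K -> L K' -> L (K + K');
  coneZ : forall c K, 0 <= c -> L K -> L (c *: K);
  cone_conj : forall (U : fam) K, (forall j, U j \is unitarymx) -> L K ->
    L (gtensor U *m K *m (gtensor U)^t*);
  cone_scalar : forall c, c \is Num.real -> L c%:M;
  cone_commutator : forall K K', L K -> L (- K) -> L K' -> L (- K') ->
    L ('i *: (K *m K' - K' *m K))
}.

Variables (L : op -> Prop) (coneL : local_cone L).
Implicit Types A B U : fam.

Lemma cone0 : L 0.
Proof. by have := cone_scalar coneL (real0 C); rewrite -scalemx1 scale0r. Qed.

Lemma cone_sum (I : finType) (P : pred I) (F : I -> op) : (forall i, P i -> L (F i)) ->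
  L (\sum_(i | P i) F i).
Proof. by move=> h; elim/big_ind: _ => //; [exact: cone0|exact: (coneD coneL)]. Qed.

Section Factor.
Variable j : 'I_n.
Implicit Types (Phi Psi : 'M[C]_(d j) -> 'M[C]_(d j)).

(** The action of Phi on qudit j is stated on presentations of operators as combinations of tensors.
    No extension of Phi to all operators has to be defined or shown independent of the
    presentation. *)
Definition preserves Phi := forall (I : finType) (c : I -> C) (A : I -> fam),
  L (\sum_i c i *: gtensor (A i)) ->
  L (\sum_i c i *: gtensor (with_factor (A i) (Phi (A i j)))).

Lemma eq_preserves Phi Psi : Phi =1 Psi -> preserves Phi -> preserves Psi.
Proof.
by move=> e h I c A /h; congr L; apply: eq_bigr => i _; rewrite e.
Qed.

Lemma preserves_id : preserves id.
Proof. by move=> I c A; congr L; apply: eq_bigr => i _; rewrite gtensor_with_id. Qed.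

Lemma preserves_comp Phi Psi : preserves Phi -> preserves Psi ->
  preserves (fun X => Phi (Psi X)).
Proof.
move=> hP hQ I c A /hQ /hP; congr L; apply: eq_bigr => i _.
by rewrite with_factor_in gtensor_with2.
Qed.

Lemma preservesD Phi Psi : preserves Phi -> preserves Psi ->
  preserves (fun X => Phi X + Psi X).
Proof.
move=> hP hQ I c A h; have := coneD coneL (hP _ _ _ h) (hQ _ _ _ h).
by congr L; rewrite -big_split; apply: eq_bigr => i _; rewrite gtensor_withD scalerDr.
Qed.

Lemma preservesZ a Phi : 0 <= a -> preserves Phi -> preserves (fun X => a *: Phi X).
Proof.
move=> a0 hP I c A h; have := coneZ coneL a0 (hP _ _ _ h).
congr L; rewrite scaler_sumr; apply: eq_bigr => i _.
by rewrite gtensor_withZ !scalerA mulrC.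
Qed.

Lemma preserves0 : preserves (fun=> 0).
Proof. by apply: eq_preserves (preservesZ (lexx 0) preserves_id) => X;
  rewrite scale0r. Qed.

Lemma preserves_sum (J : finType) (P : pred J) (F : J -> 'M[C]_(d j) -> 'M[C]_(d j)) :
  (forall k, P k -> preserves (F k)) -> preserves (fun X => \sum_(k | P k) F k X).
Proof.
move=> h; apply: (@eq_preserves (\sum_(k | P k) F k)); first by move=> X;
  rewrite fct_sumE.
elim/big_ind: _ => //; first exact: preserves0.
by move=> f g hf hg; exact: (preservesD hf hg).
Qed.

Lemma preserves_conj (U : 'M[C]_(d j)) : U \is unitarymx ->
  preserves (fun X => U *m X *m U^t*).
Proof.
move=> uU I c A h; have := cone_conj coneL (with_factor_unitary uU) h.
congr L; rewrite mulmx_sumr mulmx_suml; apply: eq_bigr => i _.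
by rewrite -scalemxAr -scalemxAl gtensor_with_conj.
Qed.

(** The identity map occurs in Phi with positive weight a, and what remains still preserves L.
    Without negation, this is how -K is extracted from an average that contains K. *)
Definition dominates Phi := preserves Phi /\
  exists2 a : C, 0 < a & preserves (fun X => Phi X - a *: X).

(** The remainder is (Phi - a) after Psi, plus a times (Psi - b). *)
Lemma dominates_comp Phi Psi : dominates Phi -> dominates Psi ->
  dominates (fun X => Phi (Psi X)).
Proof.
move=> [pP [a a0 hP]] [pQ [b b0 hQ]]; split; first exact: preserves_comp.
exists (a * b); first exact: mulr_gt0.
have := preservesD (preserves_comp hP pQ) (preservesZ (ltW a0) hQ).
by apply: eq_preserves => X; rewrite scalerBr scalerA addrA subrK.
Qed.

Lemma dominatesZ a Phi : 0 < a -> dominates Phi -> dominates (fun X => a *: Phi X).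
Proof.
move=> a0 [pP [b b0 hP]]; split; first exact: preservesZ (ltW a0) pP.
exists (a * b); first exact: mulr_gt0.
by apply: eq_preserves (preservesZ (ltW a0) hP) => X; rewrite scalerBr scalerA.
Qed.

Lemma dominates_id : dominates id.
Proof.
split; first exact: preserves_id.
exists 1; first exact: ltr01.
by apply: eq_preserves preserves0 => X; rewrite scale1r subrr.
Qed.

Lemma dominates_dephase r : dominates (@dephase C (d j) r).
Proof.
elim: r => [|k r IH]; first exact: dominates_id.
apply: (@dominates_comp (fun Y => Y + flip C k *m Y *m (flip C k)^t*) _ _ IH).
have h := preserves_conj (flip_unitary C k).
split; first exact: preservesD preserves_id h.
exists 1; first exact: ltr01.
by apply: eq_preserves h => X; rewrite scale1r addrAC subrr add0r.
Qed.

Lemma dominates_symmetrize : dominates (@symmetrize C (d j)).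
Proof.
have h (s : 'S_(d j)) := preserves_conj (perm_unitary C s).
split; first by apply: preserves_sum => s _; exact: h.
exists 1; first exact: ltr01.
apply: (@eq_preserves (fun X => \sum_(s | s != 1%g) perm_mx s *m X *m (perm_mx s)^t*)).
  move=> X; rewrite /symmetrize [in RHS](bigD1 (1%g : 'S_(d j))) //=.
  by rewrite perm_mx1 mul1mx trmx1 map_mx1 mulmx1 scale1r addrAC subrr add0r.
by apply: preserves_sum => s _; exact: h.
Qed.

Lemma dominates_trace : dominates (fun X => (\tr X)%:M).
Proof.
pose a : C := 2 ^+ d j * (d j)`!%:R / (d j)%:R.
have a0 : 0 < a by rewrite divr_gt0 ?mulr_gt0 ?exprn_gt0 ?ltr0n ?fact_gt0 // d0.
have a0' : 0 < a^-1 by rewrite invr_gt0.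
have := dominatesZ a0' (dominates_comp dominates_symmetrize
  (dominates_dephase (enum 'I_(d j)))).
have e X : a^-1 *: symmetrize (dephase (enum 'I_(d j)) X) = (\tr X)%:M.
  by rewrite symmetrize_dephase // -/a scale_scalar_mx mulrA mulVf ?mul1r // gt_eqF.
move=> [h [b b0 hb]]; split; first exact: eq_preserves e h.
by exists b => //; apply: eq_preserves hb => X; rewrite e.
Qed.
End Factor.

(** Matrix units of the whole space are tensors of matrix units; this supplies the presentation that
    [preserves] works on. *)
Lemma op_expansion (K : op) : K = \sum_(p : 'I_#|config d| * 'I_#|config d|)
  K p.1 p.2 *: gtensor (fun j => delta_mx (digit p.1 j) (digit p.2 j)).
Proof.
have E x y : gtensor (fun j => delta_mx (digit x j) (digit y j)) = delta_mx x y :> op.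
  apply/matrixP => u v; rewrite !mxE.
  under eq_bigr do rewrite mxE.
  have [[-> ->]|uv] := (@eqP _ (u, v) (x, y)).
    by rewrite !eqxx big1 // => j _; rewrite !eqxx.
  have -> : (u == x) && (v == y) = false.
    by apply/negP => /andP[/eqP ux /eqP vy]; apply: uv; rewrite ux vy.
  have [j xyj] : exists j, ~~ ((digit u j == digit x j) && (digit v j == digit y j)).
    apply/existsP; apply/contraT => /existsPn h; exfalso; apply: uv.
    by congr (_, _); apply: digit_inj => j; have := h j;
      rewrite negbK => /andP[/eqP ? /eqP ?].
  by rewrite (bigD1 j) //= (negbTE xyj) mul0r.
rewrite -(pair_bigA _ (fun x y => K x y *:
  gtensor (fun j => delta_mx (digit x j) (digit y j)))) /=.
rewrite {1}[K]matrix_sum_delta; apply: eq_bigr => x _; apply: eq_bigr => y _.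
by rewrite E.
Qed.

Definition map_factors (r : seq 'I_n) (Phi : forall j, 'M[C]_(d j) -> 'M[C]_(d j)) A :
  fam :=
  fun j => if j \in r then Phi j (A j) else A j.

Lemma map_factors_cons k r Phi A : k \notin r ->
  gtensor (map_factors (k :: r) Phi A) =
  gtensor (with_factor (map_factors r Phi A) (Phi k (map_factors r Phi A k))).
Proof.
move=> kr; apply: eq_gtensor => j; have [->|jk] := eqVneq j k.
  by rewrite with_factor_in /map_factors mem_head (negbTE kr).
by rewrite with_factor_out // /map_factors in_cons (negbTE jk).
Qed.

Lemma cone_map_factors (r : seq 'I_n) Phi (I : finType) (c : I -> C) (A : I -> fam) :
  uniq r -> (forall j, preserves (Phi j)) -> L (\sum_i c i *: gtensor (A i)) ->
  L (\sum_i c i *: gtensor (map_factors r Phi (A i))).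
Proof.
move=> + hP hA; elim: r => [_|k r IH /= /andP[kr /IH h]]; first exact: hA.
have := hP k _ _ _ h; congr L; apply: eq_bigr => i _.
by rewrite -map_factors_cons.
Qed.

(** The same splitting as in [dominates_comp], one qudit at a time: the remainder at k acts on the
    already mapped tensors, and b times the induction hypothesis is added. *)
Lemma cone_dominates (r : seq 'I_n) Phi (I : finType) (c : I -> C) (A : I -> fam) :
  uniq r -> (forall j, dominates (Phi j)) -> L (\sum_i c i *: gtensor (A i)) ->
  exists2 a : C, 0 < a &
    L (\sum_i c i *: gtensor (map_factors r Phi (A i)) - a *: \sum_i c i *:
      gtensor (A i)).
Proof.
move=> + hP hA; elim: r => [_|k r IH /= /andP[kr ur]].
  by exists 1; rewrite ?ltr01 // scale1r subrr; exact: cone0.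
have [a a0 ha] := IH ur; have [b b0 hb] := (hP k).2.
exists (b * a); first exact: mulr_gt0.
have h := cone_map_factors ur (fun j => (hP j).1) hA.
have := coneD coneL (hb _ _ _ h) (coneZ coneL (ltW b0) ha).
congr L; rewrite scalerBr scalerA addrA; congr (_ - _).
rewrite scaler_sumr -big_split; apply: eq_bigr => i _ /=.
by rewrite -scaleNr gtensor_withD gtensor_withZ gtensor_with_id map_factors_cons //
  scalerDr !scalerA mulrN scaleNr [c i * b]mulrC subrK.
Qed.

(* Depolarising all qudits turns K into a multiple of the identity, and K itself is one
   of the averaged terms. *)
Lemma coneN K : L K -> L (- K).
Proof.
move=> LK; have := LK; rewrite {1}[K]op_expansion => LK'.
have [a a0 ha] := cone_dominates (enum_uniq 'I_n) dominates_trace LK'.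
rewrite -op_expansion in ha.
set S := \sum_i _ in ha.
have SE : S = (\tr K)%:M.
  rewrite /S [in RHS](op_expansion K) linear_sum /= -scalemx1 scaler_suml.
  apply: eq_bigr => p _.
  rewrite linearZ /= mxtrace_gtensor -scalerA; congr (_ *: _).
  rewrite scalemx1 -gtensor_scalar; apply: eq_gtensor => j.
  by rewrite /map_factors mem_enum.
have rt : \tr K \is Num.real.
  apply/CrealP; have /hermsymmxP {2}<- := cone_herm coneL LK.
  by rewrite trace_map_mx mxtrace_tr.
rewrite SE in ha; have := coneD coneL ha (cone_scalar coneL (_ : - \tr K \is Num.real)).
rewrite realN => /(_ rt); rewrite [(- \tr K)%:M]raddfN /= addrAC subrr add0r => h.
have ai : 0 <= a^-1 by rewrite invr_ge0 ltW.
have := coneZ coneL ai h.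
by rewrite scalerN scalerA mulVf ?scale1r // gt_eqF.
Qed.

Lemma cone_scale c K : c \is Num.real -> L K -> L (c *: K).
Proof.
move=> rc LK; have [c0|c0] := real_leP (real0 C) rc; first exact: (coneZ coneL).
rewrite -[c]opprK scaleNr; apply: coneN; apply: (coneZ coneL) LK.
by rewrite oppr_ge0 ltW.
Qed.

Section RealFactor.
Variable j : 'I_n.
Implicit Types (Phi Psi : 'M[C]_(d j) -> 'M[C]_(d j)).

Lemma preserves_scale a Phi : a \is Num.real -> preserves Phi ->
  preserves (fun X => a *: Phi X).
Proof.
move=> ra hP I c A h; have := cone_scale ra (hP _ _ _ h).
congr L; rewrite scaler_sumr; apply: eq_bigr => i _.
by rewrite gtensor_withZ !scalerA mulrC.
Qed.

Lemma preserves_twolevel (k l : 'I_(d j)) : k != l ->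
  preserves (fun X => \tr (twolevelZ C k l *m X) *: twolevelZ C k l).
Proof.
move=> kl.
have e2 : 2 ^+ d j != 0 :> C by rewrite expf_neq0 // pnatr_eq0.
have hD : preserves (fun X : 'M[C]_(d j) => diag_mx (\row_a X a a)).
  have r2 : (2 ^+ d j)^-1 \is @Num.real C by rewrite realV realX // realn.
  apply: eq_preserves (preserves_scale r2 (dominates_dephase (enum 'I_(d j))).1) => X.
  by rewrite dephase_enum scalerA mulVf // scale1r.
have r1 : (-1 : C) \is Num.real by rewrite realN real1.
have := preservesD hD (preserves_scale r1
  (preserves_comp (preserves_conj (perm_unitary C (tperm k l))) hD)).
by apply: eq_preserves => X; rewrite scaleN1r twolevelZ_map.
Qed.

Lemma preserves_twolevel_conj (k l : 'I_(d j)) (U V : 'M[C]_(d j)) : k != l ->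
  U \is unitarymx -> V \is unitarymx ->
  preserves (fun X => \tr (U *m twolevelZ C k l *m U^t* *m X) *:
    (V *m twolevelZ C k l *m V^t*)).
Proof.
move=> kl uU uV.
have uU' : U^t* \is unitarymx by rewrite trmxC_unitary.
have := preserves_comp (preserves_conj uV)
  (preserves_comp (preserves_twolevel kl) (preserves_conj uU')).
apply: eq_preserves => X; rewrite trmxCK -scalemxAr -scalemxAl; congr (_ *: _).
by rewrite -!mulmxA [RHS]mxtrace_mulC -!mulmxA.
Qed.

Lemma preserves_rank1 (X Y : 'M[C]_(d j)) : X \is hermsymmx -> \tr X = 0 ->
  Y \is hermsymmx -> \tr Y = 0 -> preserves (fun Z => \tr (X *m Z) *: Y).
Proof.
(* In dimension 1 there are no two levels to choose, but the traceless Y is then 0. *)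
have [d1|d1] := ltnP 1 (d j); last first.
  move=> hX tX hY tY; apply: eq_preserves (@preserves0 j) => Z.
  suff -> : Y = 0 by rewrite scaler0.
  apply/matrixP => a b; rewrite [RHS]mxE -tY /mxtrace (bigD1 a) //= big1 ?addr0.
    by congr (Y _ _); apply: ord_inj; move: (ltn_ord a) (ltn_ord b); lia.
  by move=> c /eqP []; apply: ord_inj; move: (ltn_ord a) (ltn_ord c); lia.
pose k := Ordinal (d0 j); pose l := Ordinal d1.
have kl : k != l by [].
move=> /(traceless_herm_span kl) hX /hX [r [U [rr uU ->]]].
move=> /(traceless_herm_span kl) hY /hY [r' [V [rr' uV ->]]].
have h : preserves (fun Z => \sum_a \sum_b (r a * r' b) *:
    (\tr (U a *m twolevelZ C k l *m (U a)^t* *m Z) *: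
      (V b *m twolevelZ C k l *m (V b)^t*))).
  apply: preserves_sum => a _; apply: preserves_sum => b _.
  by apply: preserves_scale; [exact: realM|exact: preserves_twolevel_conj].
apply: eq_preserves h => Z; rewrite mulmx_suml [\tr _ in RHS]linear_sum scaler_suml.
apply: eq_bigr => a _; rewrite scaler_sumr; apply: eq_bigr => b _.
by rewrite /= -scalemxAl mxtraceZ !scalerA; congr (_ *: _); ring.
Qed.

End RealFactor.

Definition product_type (S : {set 'I_n}) (A : fam) := forall j,
  A j \is hermsymmx /\ if j \in S then \tr (A j) = 0 else A j = 1%:M.

Definition contains_type (S : {set 'I_n}) := forall A, product_type S A -> L (gtensor A).

(* The trace against A, times B, is a product of single-factor maps each of which is
   a real combination of unitary conjugations. *)
Lemma cone_isolate (S : {set 'I_n}) A K : product_type S A -> L K ->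
  \tr (gtensor A *m K) != 0 -> contains_type S.
Proof.
move=> tA LK t0 B tB; have := LK; rewrite {1}[K]op_expansion => LK'.
pose Phi j (X : 'M[C]_(d j)) := \tr (A j *m X) *: B j.
have pP j : preserves (Phi j).
  have [hA tAj] := tA j; have [hB tBj] := tB j; rewrite /Phi.
  case: (j \in S) tAj tBj => tAj tBj; first exact: preserves_rank1.
  (* Off S both factors are the identity, and the map is the depolarising one. *)
  apply: eq_preserves (dominates_trace j).1 => X.
  by rewrite tAj tBj mul1mx scalemx1.
have := cone_map_factors (enum_uniq 'I_n) pP LK'.
set T := \sum_i _.
have -> : T = \tr (gtensor A *m K) *: gtensor B.
  rewrite /T [in RHS](op_expansion K) mulmx_sumr linear_sum /= scaler_suml.
  apply: eq_bigr => p _; rewrite -scalemxAr linearZ /= -scalerA; congr (_ *: _).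
  rewrite gtensorM mxtrace_gtensor -gtensorZ; apply: eq_gtensor => j.
  by rewrite /map_factors mem_enum.
have rt : \tr (gtensor A *m K) \is Num.real.
  apply: mxtrace_herm_real (cone_herm coneL LK); apply/hermsymmxP.
  by rewrite gtensor_adj; apply: eq_gtensor => j; apply/hermsymmxP; exact: (tA j).1.
move=> h; have ri : (\tr (gtensor A *m K))^-1 \is Num.real by rewrite realV.
by have := cone_scale ri h; rewrite scalerA mulVf // scale1r.
Qed.
End LocalCone.

(** * Commutators of tensors and generation of all coupling sets *)

Section TwoLevel.
Variables (C : numClosedFieldType) (d : nat) (k l : 'I_d).
Hypothesis kl : k != l.
Local Notation M := 'M[C]_d.

(** The Pauli matrices on the span of levels k and l, zero on the other levels; [twolevel1] is the
    projection onto this span. *)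
Definition twolevelX : M := delta_mx k l + delta_mx l k.
Definition twolevelY : M := 'i *: (delta_mx l k - delta_mx k l).
Definition twolevel1 : M := delta_mx k k + delta_mx l l.
Local Notation sx := twolevelX.
Local Notation sy := twolevelY.
Local Notation sz := (twolevelZ C k l).
Local Notation sp := twolevel1.

Let lk : (l == k) = false. Proof. by rewrite eq_sym; exact: negbTE. Qed.
Let kl' : (k == l) = false. Proof. exact: negbTE. Qed.

Let deltaM (a b c e : 'I_d) : delta_mx a b *m delta_mx c e = (b == c)%:R *:
  delta_mx a e :> M.
Proof.
have [->|bc] := eqVneq b c; first by rewrite mul_delta_mx scale1r.
by rewrite mul_delta_mx_0 // scale0r.
Qed.

Let tr_delta (a b : 'I_d) : \tr (delta_mx a b : M) = (a == b)%:R.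
Proof.
rewrite /mxtrace (bigD1 a) //= mxE eqxx /= big1 ?addr0 // => c ca.
by rewrite mxE (negbTE ca).
Qed.

Let delta_adj (a b : 'I_d) : (delta_mx a b : M)^t* = delta_mx b a.
Proof. by rewrite trmx_delta map_delta_mx. Qed.

Let simpl_delta := (deltaM, eqxx, lk, kl', scale0r, scale1r, addr0, add0r, subr0, sub0r).

Lemma twolevelX_herm : sx \is hermsymmx.
Proof. by apply/hermsymmxP; rewrite linearD map_mxD !delta_adj addrC. Qed.

Lemma twolevelY_herm : sy \is hermsymmx.
Proof.
apply/hermsymmxP; rewrite linearZ linearB map_mxZ map_mxB !delta_adj /= conjCi.
by rewrite scaleNr -scalerN opprB.
Qed.

Lemma twolevelZ_herm : sz \is hermsymmx.
Proof. by apply/hermsymmxP; rewrite linearB map_mxB !delta_adj. Qed.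

Lemma twolevel1_herm : sp \is hermsymmx.
Proof. by apply/hermsymmxP; rewrite linearD map_mxD !delta_adj. Qed.

Lemma twolevelX_tr : \tr sx = 0.
Proof. by rewrite linearD /= !tr_delta lk kl' addr0. Qed.

Lemma twolevelY_tr : \tr sy = 0.
Proof. by rewrite linearZ linearB /= !tr_delta lk kl' subr0 mulr0. Qed.

Lemma twolevelZ_tr : \tr sz = 0.
Proof. by rewrite linearB /= !tr_delta !eqxx subrr. Qed.

Lemma twolevel1_tr : \tr sp = 2.
Proof. by rewrite linearD /= !tr_delta !eqxx. Qed.

Lemma twolevelXY : sx *m sy = 'i *: sz.
Proof.
rewrite /sx /sy -scalemxAr mulmxDl !mulmxBr !simpl_delta.
by rewrite addrC [- _ + _]addrC.
Qed.

Lemma twolevelYX : sy *m sx = - 'i *: sz.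
Proof.
rewrite /sx /sy -scalemxAl mulmxBl !mulmxDr !simpl_delta.
by rewrite scaleNr -scalerN opprB.
Qed.

Lemma twolevelZZ : sz *m sz = sp.
Proof. by rewrite mulmxBl !mulmxBr !simpl_delta opprK. Qed.

Lemma twolevelYY : sy *m sy = sp.
Proof.
rewrite /sy -scalemxAr -scalemxAl scalerA -expr2 sqrCi mulmxBl !mulmxBr !simpl_delta.
by rewrite scaleN1r -opprD opprK addrC.
Qed.

(* Traceless, and orthogonal to twolevel1 only if d = 2. *)
Definition twolevel_detect : M := d%:R *: sp - 2 *: 1%:M.

Lemma twolevel_detect_herm : twolevel_detect \is hermsymmx.
Proof.
apply/hermsymmxP; rewrite /twolevel_detect scalemx1 linearB /= map_mxB tr_scalar_mx
  map_scalar_mx.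
by rewrite linearZ /= map_mxZ !rmorph_nat; have /hermsymmxP -> := twolevel1_herm.
Qed.

Lemma twolevel_detect_tr : \tr twolevel_detect = 0.
Proof. by rewrite linearB /= !mxtraceZ twolevel1_tr mxtrace1 [2 * _]mulrC subrr. Qed.

(** The trace equals 2(d - 2). *)
Lemma twolevel_detect1 : (2 < d)%N -> \tr (twolevel_detect *m sp) != 0.
Proof.
move=> d2; have spp : sp *m sp = sp by rewrite mulmxDl !mulmxDr !simpl_delta.
rewrite mulmxBl -!scalemxAl spp mul1mx linearB /= !mxtraceZ twolevel1_tr -mulrBl.
by rewrite mulf_neq0 ?pnatr_eq0 // subr_eq0 eqr_nat; lia.
Qed.
End TwoLevel.

Section Rule.
Variables (C : numClosedFieldType) (n : nat) (d : 'I_n -> nat).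
Local Notation fam := (forall j : 'I_n, 'M[C]_(d j)).
Hypothesis d2 : forall j, (1 < d j)%N.
Variables (L : 'M[C]_#|config d| -> Prop) (coneL : local_cone L).
Local Notation F := (contains_type L).

Let lev0 j : 'I_(d j) := Ordinal (ltnW (d2 j)).
Let lev1 j : 'I_(d j) := Ordinal (d2 j).
Let lev01 j : lev0 j != lev1 j. Proof. by []. Qed.
Let sx : fam := fun j => twolevelX C (lev0 j) (lev1 j).
Let sy : fam := fun j => twolevelY C (lev0 j) (lev1 j).
Let sz : fam := fun j => twolevelZ C (lev0 j) (lev1 j).
Let sp : fam := fun j => twolevel1 C (lev0 j) (lev1 j).
Let sd : fam := fun j => twolevel_detect C (lev0 j) (lev1 j).
Let id1_herm (m : nat) : (1%:M : 'M[C]_m) \is hermsymmx.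
Proof. by apply/hermsymmxP; rewrite trmx1 map_mx1. Qed.

(* On the overlap of S and T, the two-level factors of the two tensors anticommute
   on J and are equal elsewhere. *)
Lemma contains_commutator (S T J J' : {set 'I_n}) : F S -> F T ->
  J \subset S :&: T -> odd #|J| ->
  J' \subset (S :&: T) :\: J -> (forall j, j \in J' -> (2 < d j)%N) ->
  F ((S :\: T) :|: (T :\: S) :|: J :|: J').
Proof.
move=> FS FT JST oJ J'ST J'd.
have d0 j : (0 < d j)%N by exact: ltnW.
pose a : fam := fun j => if j \in S then if j \in J then sx j else sz j else 1%:M.
pose b : fam := fun j => if j \in T then if j \in J then sy j else sz j else 1%:M.
pose c : fam := fun j => if j \in J then sz j else if j \in S :&: T then sp j
  else if j \in S :|: T then sz j else 1%:M.
(* A tensor of the target type that is not orthogonal to c. On the overlap outside J, c is a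
   two-level projection: on J' its traceless part is detected, elsewhere its trace. *)
pose e : fam := fun j => if j \in J then sz j else if j \in J' then sd j
  else if j \in S :&: T then 1%:M else if j \in S :|: T then sz j else 1%:M.
have subJ j : j \in J -> (j \in S) && (j \in T).
  by move=> jJ; have := fintype.subsetP JST _ jJ; rewrite inE.
have subJ' j : j \in J' -> [&& j \in S, j \in T & j \notin J].
  by move=> jJ'; have := fintype.subsetP J'ST _ jJ'; rewrite !inE => /and3P[-> -> ->].
have hX j : sx j \is hermsymmx := twolevelX_herm C _ _.
have hY j : sy j \is hermsymmx := twolevelY_herm C _ _.
have hZ j : sz j \is hermsymmx := twolevelZ_herm C _ _.
have tX j : \tr (sx j) = 0 := twolevelX_tr C (lev01 j).
have tY j : \tr (sy j) = 0 := twolevelY_tr C (lev01 j).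
have tZ j : \tr (sz j) = 0 := twolevelZ_tr C (lev0 j) (lev1 j).
have ta : product_type S a by move=> j; rewrite /a; case: ifP => _ //; case: ifP.
have tb : product_type T b by move=> j; rewrite /b; case: ifP => _ //; case: ifP.
have La := FS _ ta; have Lb := FT _ tb.
have := cone_commutator coneL La (coneN d0 coneL La) Lb (coneN d0 coneL Lb).
have ab : gtensor a *m gtensor b = 'i ^+ #|J| *: gtensor c.
  rewrite gtensorM -prodr_const big_mkcond -gtensorZ; apply: eq_gtensor => j.
  rewrite /a /b /c !inE; have := subJ j.
  case: (j \in J) => /=; first by move=> /(_ isT) /andP[-> ->];
    exact: (twolevelXY C (lev01 j)).
  by move=> _; case: (j \in S); case: (j \in T);
    rewrite /= scale1r ?mulmx1 ?mul1mx // (twolevelZZ C (lev01 j)).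
have ba : gtensor b *m gtensor a = (- 'i) ^+ #|J| *: gtensor c.
  rewrite gtensorM -prodr_const big_mkcond -gtensorZ; apply: eq_gtensor => j.
  rewrite /a /b /c !inE; have := subJ j.
  case: (j \in J) => /=; first by move=> /(_ isT) /andP[-> ->];
    exact: (twolevelYX C (lev01 j)).
  by move=> _; case: (j \in S); case: (j \in T);
    rewrite /= scale1r ?mulmx1 ?mul1mx // (twolevelZZ C (lev01 j)).
rewrite ab ba -scalerBl scalerA.
set w := _ * _ => Lc.
(* For odd |J| the powers of i and -i are opposite, so w is twice a power of i. *)
have w0 : w != 0.
  rewrite /w exprNn -signr_odd oJ expr1 mulN1r opprK -mulr2n.
  by rewrite mulf_neq0 ?neq0Ci // mulrn_eq0 /= expf_neq0 ?neq0Ci.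
have te : product_type ((S :\: T) :|: (T :\: S) :|: J :|: J') e.
  move=> j; rewrite /e !inE; have := subJ j; have := subJ' j.
  case: (j \in J) => /= [_ /(_ isT) /andP[-> ->]|]; first by rewrite /= ?orbT.
  case: (j \in J') => /= [/(_ isT) /and3P[-> -> _] _|_ _].
    by rewrite /= ; split; [exact: twolevel_detect_herm|exact: twolevel_detect_tr].
  by case: (j \in S); case: (j \in T); rewrite /= ?orbF.
apply: (cone_isolate d0 coneL te Lc).
rewrite -scalemxAr mxtraceZ gtensorM mxtrace_gtensor mulf_neq0 //.
apply/prodf_neq0 => j _; rewrite /e /c !inE.
have tZZ : \tr (sz j *m sz j) != 0.
  by rewrite (twolevelZZ C (lev01 j)) twolevel1_tr pnatr_eq0.
have := subJ j; have := subJ' j; have := J'd j.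
case: (j \in J) => //; case: (j \in J') => [/(_ isT) h /(_ isT) /and3P[-> -> _] _|_ _ _].
  exact: twolevel_detect1.
case: (j \in S); case: (j \in T) => //=; rewrite ?mul1mx //.
  by rewrite twolevel1_tr pnatr_eq0.
by rewrite mxtrace1 pnatr_eq0 -lt0n.
Qed.
End Rule.

(** * Combinatorics of coupling sets *)

Section Hypergraph.
Variables (I : finType) (F : {set I} -> Prop).
Hypothesis F_rule : forall S T J : {set I}, F S -> F T -> J \subset S :&: T -> odd #|J| ->
  F ((S :\: T) :|: (T :\: S) :|: J).

(** S with itself yields its odd subsets, among them S \ j. The sets S and S \ j differ in j alone,
    and J = {i} adds i. *)
Lemma even_pair (S : {set I}) i j : F S -> ~~ odd #|S| -> i \in S -> j \in S -> i != j ->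
  F [set i; j].
Proof.
move=> FS eS iS jS ij.
have FSj : F (S :\ j).
  have := @F_rule S S (S :\ j) FS FS.
  rewrite finset.setIid subsetDl finset.setDv !finset.set0U => /(_ isT); apply.
  by move: eS; rewrite (cardsD1 j) jS add1n /= negbK.
have := @F_rule S (S :\ j) [set i] FS FSj.
rewrite finset.sub1set !inE ij iS cards1 => /(_ isT isT).
congr F; apply/setP => x; rewrite !inE.
have [->|xi] := eqVneq x i; first by rewrite orbT.
have [->|xj] := eqVneq x j; first by rewrite jS.
by case: (x \in S).
Qed.

Lemma rule_single (S T : {set I}) i : F S -> F T -> i \in S -> i \in T ->
  F ((S :\: T) :|: (T :\: S) :|: [set i]).
Proof. by move=> FS FT iS iT; apply: F_rule;
  rewrite ?cards1 // finset.sub1set inE iS. Qed.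

(** The two pairs meet in j and give the triple {i, j, k}; the triple and {i, j} with J = {i} give
    {i, k}. *)
Lemma pair_trans i j k : i != j -> j != k -> i != k -> F [set i; j] -> F [set j; k] ->
  F [set i; k].
Proof.
move=> ij jk ik Fij Fjk.
have F3 := @rule_single _ _ j Fij Fjk; rewrite !inE !eqxx orbT in F3.
have := @rule_single _ _ i (F3 isT isT) Fij; rewrite !inE !eqxx.
rewrite (negbTE ij) (negbTE ik) /= => /(_ isT isT).
congr F; apply/setP => x; rewrite !inE.
have [->|xi] := eqVneq x i; first by rewrite orbT.
have [->|xj] := eqVneq x j; first by rewrite (negbTE jk) orbT.
by case: (x == k).
Qed.

Hypothesis F_cross : forall S : {set I}, S != finset.set0 -> ~: S != finset.set0 ->
  exists2 T, F T & ~~ (T \subset S) && ~~ (T \subset ~: S).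

(** By [pair_trans] the elements paired with i0 form, with i0, a clique S that no pair leaves. If S
    is not everything, some T in F contains a j in S and a k outside, and the pair {j, k} is derived
    for a contradiction. *)
Lemma all_pairs i0 j0 : i0 != j0 -> F [set i0; j0] -> forall i j : I, i != j ->
  F [set i; j].
Proof.
move=> ij0 F0.
pose S := [set k | (k == i0) || `[< F [set i0; k] >]]%SET.
have inS k : (k \in S) = (k == i0) || `[< F [set i0; k] >] by rewrite /S inE.
have S0 i : i \in S -> i != i0 -> F [set i0; i].
  by rewrite inS => /orP[->//|/asboolP].
have SF i j : i \in S -> j \in S -> i != j -> F [set i; j].
  move=> iS jS ij; have [ii0|ii0] := eqVneq i i0.
    by rewrite ii0; apply: S0 => //; rewrite -ii0 eq_sym.
  have [ji0|ji0] := eqVneq j i0; first by rewrite finset.setUC ji0; apply: S0.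
  have Fi := S0 _ iS ii0; rewrite finset.setUC in Fi.
  by apply: (pair_trans ii0 _ ij Fi (S0 _ jS ji0)); rewrite eq_sym.
have i0S : i0 \in S by rewrite inS eqxx.
have Sext i k : i \in S -> k \notin S -> ~ F [set i; k].
  move=> iS kS Fik.
  have ki0 : k != i0 by apply: contraNneq kS => ->.
  have ik : i != k by apply: contraNneq kS => <-.
  move: kS; rewrite inS (negbTE ki0) /= => /asboolP; apply.
  have [ii0|ii0] := eqVneq i i0; first by rewrite -ii0.
  by apply: (pair_trans _ ik _ (S0 _ iS ii0) Fik); rewrite eq_sym.
suff ST : S = [set: I]%SET by move=> i j ij; apply: SF; rewrite ?ST ?inE.
apply/eqP; apply: contraT => ST; exfalso.
have [||T FT /andP[TS TS']] := F_cross (S := S).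
- by apply/set0Pn; exists i0.
- by apply: contra ST => /eqP h; rewrite -[S]finset.setCK h finset.setC0.
have [k kT kS] := fintype.subsetPn TS.
have [j jT jS] := fintype.subsetPn TS'; rewrite inE negbK in jS.
have jk : j != k by apply: contraNneq kS => <-.
(* An odd T that contains j and k has a third element l, and {j, k, l} is an odd subset of T. *)
have [oT|eT] := boolP (odd #|T|); last exact: (Sext j k jS kS (even_pair FT eT jT kT jk)).
have [l [lT lj lk]] : exists l, [/\ l \in T, l != j & l != k].
  have : #|(T :\: [set j; k])%SET| != 0%N.
    have sT : ([set j; k] \subset T)%SET by apply/fintype.subsetP => x /set2P[]->.
    have := subset_leq_card sT; rewrite cardsDS // cards2 jk.
    by move: oT; case: #|T| => [|[|[|m]]].
  by rewrite cards_eq0 => /set0Pn [l]; rewrite !inE negb_or -andbA => /and3P[? ? ?];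
    exists l.
have F3 : F [set j; k; l].
  have := @F_rule T T [set j; k; l] FT FT;
    rewrite finset.setIid finset.setDv !finset.set0U; apply.
    by apply/fintype.subsetP => x; rewrite !inE -orbA => /or3P[]/eqP->.
  by rewrite finset.setUC cardsU1 cards2 !inE negb_or lj lk jk.
(* For l in S, the pair {j, l} removes l from the triple, and J = {j} keeps j. *)
have [lS|lS] := boolP (l \in S).
  apply: (Sext j k jS kS).
  have := @rule_single _ _ j F3 (SF _ _ jS lS (_ : j != l)); rewrite eq_sym => /(_ lj).
  rewrite !inE eqxx => /(_ isT isT); congr F; apply/setP => x; rewrite !inE.
  have [->|xj] := eqVneq x j; first by rewrite orbT.
  have [->|xk] := eqVneq x k; first by rewrite eq_sym (negbTE lk).
  by case: (x == l).
(* The given pair ensures that S has an element i besides j. The triple and {j, i} with J = {j} then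
   give the even set {i, j, k, l}, to which [even_pair] applies. *)
have [i [iS ij]] : exists i, i \in S /\ i != j.
  have [ji0|ji0] := eqVneq j i0; last by exists i0; rewrite i0S eq_sym.
  by exists j0; rewrite ji0 eq_sym ij0 inS; split=> //; apply/orP; right; apply/asboolP.
apply: (Sext j k jS kS).
have ik : i != k by apply: contraNneq kS => <-.
have il : i != l by apply: contraNneq lS => <-.
have F4 := @rule_single _ _ j F3 (SF _ _ jS iS (_ : j != i)).
rewrite eq_sym in F4; move: (F4 ij); rewrite !inE eqxx => /(_ isT isT) {}F4.
apply: (even_pair F4); rewrite ?inE ?eqxx ?orbT ?(negbTE jk) ?(eq_sym k) ?(negbTE jk)
  ?(negbTE ik) //.
suff -> : ([set j; k; l] :\: [set j; i] :|: [set j; i] :\: [set j; k; l] :|: [set j] =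
  [set k; l] :|: [set i; j])%SET.
  rewrite cardsU !cards2 ij [k == l]eq_sym lk.
  suff -> : ([set k; l] :&: [set i; j])%SET = finset.set0 by rewrite cards0.
  apply/setP => x; rewrite !inE; apply/negP => /andP[/orP[]/eqP-> /orP[]/eqP h].
  - by rewrite h eqxx in ik.
  - by rewrite h eqxx in jk.
  - by rewrite h eqxx in il.
  - by rewrite h eqxx in lj.
apply/setP => x; rewrite !inE.
have [->|xj] := eqVneq x j; first by rewrite !orbT.
have [->|xk] := eqVneq x k; first by rewrite (eq_sym k) (negbTE ik).
have [->|xl] := eqVneq x l; first by rewrite (eq_sym l) (negbTE il).
by case: (x == i).
Qed.

(** Induction on the size: a singleton is an odd subset of a pair, and a larger S comes from S \ i
    and a pair {i, j} that meets it in j. *)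
Lemma all_sets i0 j0 : i0 != j0 -> F [set i0; j0] ->
  forall S : {set I}, S != finset.set0 -> F S.
Proof.
move=> ij0 F0; have Fp := all_pairs ij0 F0.
move=> S; have [m] := ubnP #|S|; elim: m S => // m IH S Sm /set0Pn [i iS].
have [S0|/set0Pn [j]] := eqVneq (S :\ i) finset.set0.
  have -> : S = [set i]%SET by rewrite -(finset.setD1K iS) S0 finset.setU0.
  have [j ij] : exists j, i != j.
    by have [<-|] := eqVneq i0 i; [exists j0|exists i0; rewrite eq_sym].
  have := @F_rule _ _ [set i] (Fp _ _ ij) (Fp _ _ ij).
  by rewrite finset.setIid finset.setDv !finset.set0U finset.sub1set !inE eqxx cards1;
    apply.
move=> jS; have FS' : F (S :\ i).
  apply: IH; last by apply/set0Pn; exists j.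
  by move: Sm; rewrite (cardsD1 i S) iS.
have ij : i != j by move: jS; rewrite !inE eq_sym => /andP[].
have := @rule_single _ _ j FS' (Fp _ _ ij) jS; rewrite !inE eqxx orbT => /(_ isT).
congr F; apply/setP => x; rewrite !inE.
have [->|xi] := eqVneq x i; first by rewrite iS orbT.
have [->|xj] := eqVneq x j; first by move: jS; rewrite !inE => /andP[_ ->]; rewrite !orbT.
by case: (x \in S).
Qed.
End Hypergraph.

(** * Gell-Mann matrices *)

Section GellMann.
Variables (C : numClosedFieldType) (d : nat).
Local Notation M := 'M[C]_d.

(* The Gell-Mann matrices up to nonzero real factors. *)
Variant gm_spec : 'I_d * 'I_d -> M -> Prop :=
| GmX (a b : 'I_d) (c : C) : (a < b)%N -> c != 0 -> c \is Num.real ->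
    gm_spec (a, b) (c *: (delta_mx a b + delta_mx b a))
| GmY (a b : 'I_d) (c : C) : (a < b)%N -> c != 0 -> c \is Num.real ->
    gm_spec (b, a) ((- 'i * c) *: (delta_mx a b - delta_mx b a))
| GmOne (a : 'I_d) : a = 0%N :> nat -> gm_spec (a, a) 1%:M
| GmW (m : 'I_d) (c : C) : (0 < m)%N -> c != 0 -> c \is Num.real ->
    gm_spec (m, m) (c *: (\sum_(b < d | (b < m)%N) delta_mx b b - m%:R *: delta_mx m m)).

Lemma mxtrace_deltaM (a b : 'I_d) (X : M) : \tr (delta_mx a b *m X) = X b a.
Proof.
rewrite /mxtrace (bigD1 a) //= [X in _ + X]big1 ?addr0.
  rewrite mxE (bigD1 b) //= [X in _ + X]big1 ?addr0 ?mxE ?eqxx ?mul1r //.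
  by move=> c /negbTE cb; rewrite mxE cb andbF mul0r.
move=> c /negbTE ca; rewrite mxE big1 // => e _.
by rewrite mxE ca mul0r.
Qed.

Lemma mxtrace_XM a b c (X : M) :
  \tr (c *: (delta_mx a b + delta_mx b a) *m X) = c * (X b a + X a b).
Proof. by rewrite -scalemxAl mxtraceZ mulmxDl mxtraceD !mxtrace_deltaM. Qed.

Lemma mxtrace_YM a b c (X : M) :
  \tr (c *: (delta_mx a b - delta_mx b a) *m X) = c * (X b a - X a b).
Proof. by rewrite -scalemxAl mxtraceZ mulmxBl linearB /= !mxtrace_deltaM. Qed.

Lemma mxtrace_WM (m : 'I_d) c (X : M) :
  \tr (c *: (\sum_(b < d | (b < m)%N) delta_mx b b - m%:R *: delta_mx m m) *m X) =
  c * (\sum_(b < d | (b < m)%N) X b b - m%:R * X m m).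
Proof.
rewrite -scalemxAl mxtraceZ mulmxBl linearB /= -scalemxAl mxtraceZ mxtrace_deltaM.
rewrite mulmx_suml raddf_sum /=; congr (_ * (_ - _)).
by apply: eq_bigr => b _; rewrite mxtrace_deltaM.
Qed.

Lemma W_entry (m : 'I_d) c a b :
  (c *: (\sum_(e < d | (e < m)%N) delta_mx e e - m%:R *: delta_mx m m) : M) a b =
  (c * ((a < m)%:R - m%:R * (a == m)%:R)) *+ (a == b).
Proof.
rewrite !mxE summxE.
have [<-|ab] := eqVneq a b; last first.
  rewrite mulr0n big1; last first.
    move=> e _; rewrite mxE; case: eqVneq => [ae|//]; rewrite -ae eq_sym.
    by rewrite (negbTE ab).
  case: eqVneq => [am|]; last by rewrite mulr0 subrr mulr0.
  by rewrite -am eq_sym (negbTE ab) mulr0 subrr mulr0.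
rewrite mulr1n andbb; congr (_ * (_ - _)).
have [am|am] := boolP (a < m)%N.
  rewrite (bigD1 a) //= mxE !eqxx big1 ?addr0 // => e /andP[_ /negbTE ea].
  by rewrite mxE eq_sym ea.
rewrite big1 // => e em; rewrite mxE; case: eqVneq => // ae.
by rewrite ae em in am.
Qed.

Lemma sum_lt_ord (m : 'I_d) (f : nat -> C) :
  \sum_(b < d | (b < m)%N) f b = \sum_(0 <= b < m) f b.
Proof.
rewrite (big_nat_widen _ _ d) ?(ltnW (ltn_ord m)) // big_mkord.
by apply: eq_bigl => b; rewrite ?andbT.
Qed.

Lemma gm_spec_herm p X : gm_spec p X -> X \is hermsymmx.
Proof.
have da (a b : 'I_d) : (delta_mx a b : M)^t* =
  delta_mx b a by rewrite trmx_delta map_delta_mx.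
case=> [a b c _ _ /CrealP rc|a b c _ _ /CrealP rc|a _|m c _ _ rc]; apply/hermsymmxP.
- by rewrite linearZ linearD map_mxZ map_mxD !da /= rc addrC.
- rewrite linearZ linearB map_mxZ map_mxB !da /= rmorphM rmorphN /= conjCi rc.
  by rewrite opprK mulNr scaleNr -scalerN opprB.
- by rewrite trmx1 map_mx1.
apply/matrixP => a b; rewrite mxE mxE !W_entry.
have [->|ab] := eqVneq b a; last by rewrite !mulr0n rmorph0.
by rewrite mulr1n; apply/CrealP; rewrite realM // realB ?realM ?realn.
Qed.

Lemma gm_spec_trace p X : gm_spec p X ->
  (X = 1%:M /\ p.1 = 0%N :> nat /\ p.2 = 0%N :> nat) \/ \tr X = 0.
Proof.
case=> [a b c ab _ _|a b c ab _ _|a a0|m c m0 _ _]; [right|right|by left|right].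
- rewrite -[_ *: _]mulmx1 mxtrace_XM !mxE eq_sym.
  by rewrite (_ : (a == b) = false) ?addr0 ?mulr0 //; apply/eqP => e;
    rewrite e ltnn in ab.
- rewrite -[_ *: _]mulmx1 mxtrace_YM !mxE eq_sym.
  by rewrite (_ : (a == b) = false) ?subr0 ?mulr0 //; apply/eqP => e;
    rewrite e ltnn in ab.
rewrite -[_ *: _]mulmx1 mxtrace_WM mxE eqxx mulr1.
rewrite (eq_bigr (fun=> 1)); last by move=> b _; rewrite mxE eqxx.
by rewrite (sum_lt_ord m (fun=> 1)) sumr_const_nat subn0 subrr mulr0.
Qed.

(** X is symmetric and Y antisymmetric, and both have zero diagonal, which settles them against each
    other and against W. For m < k, the matrix W at k is constant on the levels that support W at m,
    so the trace is a multiple of the trace of the latter. *)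
Lemma gm_spec_ortho p q X Y : gm_spec p X -> gm_spec q Y -> p != q -> \tr (X *m Y) = 0.
Proof.
have nlt (a b : 'I_d) : (a < b)%N -> (a == b) = false /\ (b == a) = false.
  by move=> ab; split; apply/eqP => e; rewrite e ltnn in ab.
have WX (m a b : 'I_d) c (Z : M) : (a < b)%N -> (forall x, Z x x = 0) ->
    \tr (c *: (\sum_(e < d | (e < m)%N) delta_mx e e - m%:R *: delta_mx m m) *m Z) = 0.
  by move=> _ Z0; rewrite mxtrace_WM Z0 big1 ?mulr0 ?subrr ?mulr0.
have X0 (a b : 'I_d) c : (a < b)%N ->
  forall x, (c *: (delta_mx a b + delta_mx b a) : M) x x = 0.
  move=> ab x; rewrite !mxE; have [e1 e2] := nlt _ _ ab.
  by have [->|_] := eqVneq x a; rewrite ?e1 /= ?andbF ?addr0 ?mulr0.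
have Y0 (a b : 'I_d) c : (a < b)%N ->
  forall x, (c *: (delta_mx a b - delta_mx b a) : M) x x = 0.
  move=> ab x; rewrite !mxE; have [e1 e2] := nlt _ _ ab.
  by have [->|_] := eqVneq x a; rewrite ?e1 /= ?andbF ?subr0 ?mulr0.
have T0 r Z : gm_spec r Z -> (0 < r.1)%N || (0 < r.2)%N -> \tr Z = 0.
  by move=> /gm_spec_trace [[_ [-> ->]]|].
have WW (m k : 'I_d) c c' : (m < k)%N ->
  \tr ((c *: (\sum_(e < d | (e < m)%N) delta_mx e e - m%:R *: delta_mx m m) : M) *m
   (c' *: (\sum_(e < d | (e < k)%N) delta_mx e e - k%:R *: delta_mx k k))) = 0.
  move=> mk; rewrite mxtrace_WM W_entry eqxx mk (nlt _ _ mk).1 mulr0 subr0 mulr1 mulr1n.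
  rewrite (eq_bigr (fun=> c')); last first.
    move=> b bm; have bk := ltn_trans bm mk.
    by rewrite W_entry eqxx bk (nlt _ _ bk).1 mulr0 subr0 mulr1 mulr1n.
  by rewrite (sum_lt_ord m (fun=> c')) sumr_const_nat subn0 mulr_natl subrr mulr0.
move=> pX qY; move: (T0 _ _ pX) (T0 _ _ qY).
case: p X / pX => [a b c ab _ _|a b c ab _ _|a a0|m c m0 _ _];
case: q Y / qY => [a' b' c' ab' _ _|a' b' c' ab' _ _|a' a0'|m' c' m0' _ _] TX TY pq.
- rewrite mxtrace_XM !mxE.
  have [e1 e2] := nlt _ _ ab; have [e1' e2'] := nlt _ _ ab'.
  have n1 : (a == a') && (b == b') = false by apply: contraNF pq => /andP[/eqP-> /eqP->].
  have n2 : (a == b') && (b == a') = false.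
    by apply/negP => /andP[/eqP h /eqP h']; move: ab; rewrite h h' ltnNge ltnW.
  by rewrite [(b == a') && _]andbC [(b == b') && _]andbC n1 n2 !addr0 !mulr0 addr0 mulr0.
- by rewrite mxtrace_XM !mxE [(b == a') && _]andbC [(b == b') && _]andbC; ring.
- by rewrite mulmx1; apply: TX; rewrite /= (leq_ltn_trans _ ab) ?orbT.
- by rewrite mxtrace_mulC; apply: (WX _ a b _ _ ab); exact: X0.
- by rewrite mxtrace_YM !mxE [(b == a') && _]andbC [(b == b') && _]andbC; ring.
- rewrite mxtrace_YM !mxE.
  have [e1 e2] := nlt _ _ ab; have [e1' e2'] := nlt _ _ ab'.
  have n1 : (a == a') && (b == b') = false by apply: contraNF pq => /andP[/eqP-> /eqP->].
  have n2 : (a == b') && (b == a') = false.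
    by apply/negP => /andP[/eqP h /eqP h']; move: ab; rewrite h h' ltnNge ltnW.
  by rewrite [(b == a') && _]andbC [(b == b') && _]andbC n1 n2 !subr0 !mulr0 subr0 mulr0.
- by rewrite mulmx1; apply: TX; rewrite /= (leq_ltn_trans _ ab).
- by rewrite mxtrace_mulC; apply: (WX _ a b _ _ ab); exact: Y0.
- by rewrite mul1mx; apply: TY; rewrite /= (leq_ltn_trans _ ab') ?orbT.
- by rewrite mul1mx; apply: TY; rewrite /= (leq_ltn_trans _ ab').
- by move: pq; rewrite (_ : a = a') ?eqxx //; apply: val_inj; rewrite /= a0 a0'.
- by rewrite mul1mx; apply: TY; rewrite /= m0'.
- by apply: (WX _ a' b' _ _ ab'); exact: X0.
- by apply: (WX _ a' b' _ _ ab'); exact: Y0.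
- by rewrite mulmx1; apply: TX; rewrite /= m0.
- have [mm|mm|mm] := ltngtP m m'; first exact: WW.
    by rewrite mxtrace_mulC; exact: WW.
  by move: pq; rewrite (_ : m = m') ?eqxx //; exact: val_inj.
Qed.

Lemma gm_spec_norm p X : gm_spec p X -> \tr (X *m X) != 0.
Proof.
have nlt (a b : 'I_d) : (a < b)%N -> (a == b) = false /\ (b == a) = false.
  by move=> ab; split; apply/eqP => e; rewrite e ltnn in ab.
case=> [a b c ab c0 _|a b c ab c0 _|a a0|m c m0 c0 _].
- rewrite mxtrace_XM !mxE !eqxx; have [-> ->] := nlt _ _ ab.
  by rewrite /= add0r addr0 -mulrDr !mulf_neq0 // -natrD pnatr_eq0.
- rewrite mxtrace_YM !mxE !eqxx; have [-> ->] := nlt _ _ ab.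
  by rewrite /= sub0r subr0 -mulrBr !mulf_neq0 ?oppr_eq0 ?neq0Ci //.
- by rewrite mul1mx mxtrace1 pnatr_eq0 -lt0n (leq_ltn_trans _ (ltn_ord a)).
rewrite mxtrace_WM W_entry eqxx ltnn sub0r mulr1 mulr1n.
rewrite (eq_bigr (fun=> c)); last first.
  move=> b bm; rewrite W_entry eqxx bm (nlt _ _ bm).1 mulr0 subr0 mulr1 mulr1n //.
rewrite (sum_lt_ord m (fun=> c)) sumr_const_nat subn0.
have -> : c *+ m - m%:R * (c * - m%:R) = c * (m * m.+1)%:R.
  by rewrite natrM -natr1 -mulr_natr; ring.
by rewrite !mulf_neq0 // pnatr_eq0 muln_eq0; case: (m : nat) m0.
Qed.

Variable g : 'I_d * 'I_d -> M.
Hypothesis gP : forall p, gm_spec p (g p).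

(* A matrix orthogonal to all X and Y is diagonal, and orthogonality to the W forces
   its diagonal to be constant. *)
Lemma gm_complete (Z : M) : (forall p, \tr (g p *m Z) = 0) -> Z = 0.
Proof.
move=> h.
have off (a b : 'I_d) : (a < b)%N -> Z a b = 0 /\ Z b a = 0.
  move=> ab.
  have hX : Z b a + Z a b = 0.
    have := h (a, b); have := gP (a, b); move: (g _) => G.
    case E : _ _ / => [a' b' c ab' c0 rc|a' b' c ab' c0 rc|a' a0|m c m0 c0 rc];
      case: E ab => -> -> ab; rewrite ?ltnn // in ab.
      by rewrite mxtrace_XM => /eqP; rewrite mulf_eq0 (negbTE c0) => /eqP.
    by rewrite ltnNge ltnW in ab.
  have hY : Z b a - Z a b = 0.
    have := h (b, a); have := gP (b, a); move: (g _) => G.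
    case E : _ _ / => [a' b' c ab' c0 rc|a' b' c ab' c0 rc|a' a0|m c m0 c0 rc];
      case: E ab => -> -> ab; rewrite ?ltnn // in ab.
      by rewrite ltnNge ltnW in ab.
    by rewrite mxtrace_YM => /eqP;
      rewrite mulf_eq0 mulf_eq0 oppr_eq0 (negbTE (neq0Ci _)) (negbTE c0) => /eqP.
  have e : Z b a = Z a b by apply/eqP; rewrite -subr_eq0 hY.
  by move/eqP: hX; rewrite e -mulr2n mulrn_eq0 /= => /eqP ->.
(* If the entries below m all equal [Z k k], orthogonality to W at m says that m times [Z k k] is m
   times [Z m m]. *)
have diag (m k : 'I_d) : k = 0%N :> nat -> Z m m = Z k k.
  move=> k0; have [r] := ubnP (val m); elim: r m => // r IH m /ltnSE mr.
  have [m0|m0] := posnP m; first by congr (Z _ _); apply: val_inj; rewrite /= m0 k0.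
  have := h (m, m); have := gP (m, m); move: (g _) => G.
  case E : _ _ / => [a' b' c ab' c0 rc|a' b' c ab' c0 rc|a' a0|m' c m0' c0 rc].
  - by case: E ab' => <- <-; rewrite ltnn.
  - by case: E ab' => <- <-; rewrite ltnn.
  - by case: E => em _; rewrite em a0 in m0.
  case: E => <- _; rewrite mxtrace_WM => /eqP; rewrite mulf_eq0 (negbTE c0) /=.
  rewrite (eq_bigr (fun=> Z k k)); last by move=> b bm; apply: IH; exact: leq_trans bm mr.
  rewrite (sum_lt_ord m (fun=> Z k k)) sumr_const_nat subn0 -[Z k k *+ m]mulr_natl
    -mulrBr mulf_eq0.
  by rewrite pnatr_eq0 -leqn0 leqNgt m0 subr_eq0 => /eqP.
apply/matrixP => a b; rewrite [RHS]mxE.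
have [ab|ab|/val_inj <-] := ltngtP a b; [exact: (off _ _ ab).1|exact: (off _ _ ab).2|].
have d0 : (0 < d)%N by exact: leq_ltn_trans (ltn_ord a).
pose k := Ordinal d0; rewrite (diag a k) //.
have := h (k, k); have := gP (k, k); move: (g _) => G.
case E : _ _ / => [a' b' c ab' c0 rc|a' b' c ab' c0 rc|a' a0|m' c m0' c0 rc].
- by case: E ab' => <- <-; rewrite ltnn.
- by case: E ab' => <- <-; rewrite ltnn.
- rewrite mul1mx /mxtrace (eq_bigr (fun=> Z k k)); last by move=> x _; exact: diag.
  rewrite sumr_const card_ord => /eqP; rewrite mulrn_eq0 => /orP[|/eqP//].
  by rewrite -leqn0 leqNgt d0.
by case: E m0' => <-.
Qed.

Lemma gm_expand (Z : M) : Z = \sum_p (\tr (g p *m Z) / \tr (g p *m g p)) *: g p.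
Proof.
apply/eqP; rewrite -subr_eq0; apply/eqP; apply: gm_complete => q.
rewrite mulmxBr linearB /=; apply/eqP; rewrite subr_eq0 eq_sym; apply/eqP.
rewrite mulmx_sumr raddf_sum /= [LHS](bigD1 q) //= [X in _ + X]big1 ?addr0; last first.
  move=> p pq; rewrite -scalemxAr mxtraceZ (gm_spec_ortho (gP q) (gP p)) ?mulr0 //.
  by rewrite eq_sym.
by rewrite -scalemxAr mxtraceZ divfK // (gm_spec_norm (gP q)).
Qed.
End GellMann.

Section GellMannTensor.
Variables (C : numClosedFieldType) (n : nat) (d : 'I_n -> nat).
Local Notation fam := (forall j : 'I_n, 'M[C]_(d j)).
Local Notation op := 'M[C]_#|config d|.
Variable g : forall j : 'I_n, 'I_(d j) * 'I_(d j) -> 'M[C]_(d j).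
Arguments g : clear implicits.
Hypothesis gP : forall j p, gm_spec p (g j p).
Arguments gP : clear implicits.

Definition gm_tensor (alpha : gm_index d) : op := gtensor (fun j => g j (alpha j)).

Lemma gm_tensor_ortho alpha beta : alpha != beta ->
  \tr (gm_tensor alpha *m gm_tensor beta) = 0.
Proof.
move=> ab; rewrite gtensorM mxtrace_gtensor.
have [j abj] : exists j, alpha j != beta j.
  apply/existsP; apply: contraR ab => /existsPn h; apply/eqP/ffunP => j.
  by apply/eqP; have := h j; rewrite negbK.
by rewrite (bigD1 j) //= (gm_spec_ortho (gP _ _) (gP _ _)) // mul0r.
Qed.

Lemma gm_tensor_norm alpha : \tr (gm_tensor alpha *m gm_tensor alpha) != 0.
Proof.
by rewrite gtensorM mxtrace_gtensor; apply/prodf_neq0 => j _;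
  apply: gm_spec_norm (gP _ _).
Qed.

Lemma gm_tensor_herm alpha : gm_tensor alpha \is hermsymmx.
Proof.
apply/hermsymmxP; rewrite gtensor_adj; apply: eq_gtensor => j.
by apply/hermsymmxP; apply: gm_spec_herm (gP _ _).
Qed.

Lemma mxtrace_gm_tensor_sum (h : gm_index d -> C) alpha :
  \tr (gm_tensor alpha *m \sum_beta h beta *: gm_tensor beta) =
    h alpha * \tr (gm_tensor alpha *m gm_tensor alpha).
Proof.
rewrite mulmx_sumr raddf_sum /= [LHS](bigD1 alpha) //= [X in _ + X]big1 ?addr0.
  by rewrite -scalemxAr mxtraceZ.
by move=> beta ba; rewrite -scalemxAr mxtraceZ gm_tensor_ortho ?mulr0 // eq_sym.
Qed.

(** A tensor is expanded factor by factor and multiplied out; linearity over tensors of matrix units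
    extends this to every operator. *)
Lemma gm_tensor_expand (K : op) :
  K = \sum_alpha (\tr (gm_tensor alpha *m K) / \tr
    (gm_tensor alpha *m gm_tensor alpha)) *: gm_tensor alpha.
Proof.
have T (A : fam) : gtensor A =
  \sum_alpha (\tr (gm_tensor alpha *m gtensor A) / \tr
    (gm_tensor alpha *m gm_tensor alpha)) *: gm_tensor alpha.
  transitivity (gtensor (fun j => \sum_p (\tr (g j p *m A j) / \tr (g j p *m g j p)) *:
    g j p)).
    by apply: eq_gtensor => j; exact: gm_expand (gP j) (A j).
  apply/matrixP => x y; rewrite mxE summxE.
  under eq_bigr do rewrite summxE.
  rewrite (prod_sum_dffun (T_ := fun j => ('I_(d j) * 'I_(d j))%type)
    (fun j p => ((\tr (g j p *m A j) / \tr (g j p *m g j p)) *: g j p) (digit x j)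
      (digit y j))).
  apply: eq_bigr => alpha _;
    rewrite !mxE !gtensorM !mxtrace_gtensor -prodf_div -big_split.
  by apply: eq_bigr => j _; rewrite mxE.
rewrite {1}[K]op_expansion; under eq_bigr do rewrite T scaler_sumr.
rewrite exchange_big; apply: eq_bigr => alpha _.
rewrite [in RHS](op_expansion K) mulmx_sumr raddf_sum /= mulr_suml scaler_suml.
by apply: eq_bigr => p _; rewrite -scalemxAr mxtraceZ scalerA mulrA.
Qed.

Hypothesis d2 : forall j, (1 < d j)%N.

Definition gm_coupled (alpha : gm_index d) : {set 'I_n} :=
  [set j | \tr (g j (alpha j)) == 0]%SET.

Lemma gm_tensor_type alpha : product_type (gm_coupled alpha) (fun j => g j (alpha j)).
Proof.
move=> j; split; first exact: gm_spec_herm (gP _ _).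
rewrite inE; have [[-> _]|->] := gm_spec_trace (gP j (alpha j)); last by rewrite eqxx.
by case: ifP => // /eqP.
Qed.

Variables (L : op -> Prop) (coneL : local_cone L).
Variables (H : op) (h : gm_index d -> C).
Hypothesis LH : L H.
Hypothesis Hh : H = \sum_alpha h alpha *: gm_tensor alpha.

Let d0 j : (0 < d j)%N. Proof. exact: ltnW. Qed.

Lemma contains_term alpha : h alpha != 0 -> contains_type L (gm_coupled alpha).
Proof.
move=> ha; apply: (cone_isolate d0 coneL (gm_tensor_type alpha) LH).
by rewrite -/(gm_tensor alpha) Hh mxtrace_gm_tensor_sum mulf_neq0 // gm_tensor_norm.
Qed.

Hypothesis n2 : (1 < n)%N.
Hypothesis connected : forall S : {set 'I_n}, S != finset.set0 ->
  (~: S)%SET != finset.set0 ->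
  exists2 alpha, h alpha != 0 & ~~ (gm_coupled alpha \subset S) && ~~
    (gm_coupled alpha \subset ~: S)%SET.
Hypothesis not_odd : (exists j, (2 < d j)%N) \/
  exists alpha, [/\ h alpha != 0, gm_coupled alpha != finset.set0 & ~~ odd #|gm_coupled
    alpha|].

Lemma contains_pair : exists i j, i != j /\ contains_type L [set i; j]%SET.
Proof.
have rule := @contains_commutator _ _ _ d2 _ coneL.
case: not_odd => [[j dj]|[alpha [ha S0 eS]]].
  (* A term that crosses the cut between j and the rest couples j and some k. Bracketing its type
     with itself, with J = {k} and J' = {j}, leaves the pair. *)
  have [||alpha ha /andP[aj aj']] := connected (S := [set j]%SET).
  - by apply/set0Pn; exists j; rewrite inE.
  - rewrite -cards_eq0 cardsCs finset.setCK card_ord cards1 subn_eq0 -ltnNge; exact: n2.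
  have [k kS kj] := fintype.subsetPn aj; rewrite inE in kj.
  have jS : j \in gm_coupled alpha.
    have [i iS hi] := fintype.subsetPn aj'; rewrite !inE negbK in hi.
    by rewrite -(eqP hi).
  have := contains_term ha; move: kS jS; move: (gm_coupled alpha) => T kS jS FT.
  exists k, j; split; first exact: kj.
  have := rule _ _ [set k]%SET [set j]%SET FT FT.
  rewrite finset.setIid finset.setDv !finset.set0U !finset.sub1set cards1 !inE kS jS.
  rewrite [j == k]eq_sym (negbTE kj); apply=> // i; rewrite inE => /eqP ->; exact: dj.
have := contains_term ha; move: S0 eS; move: (gm_coupled alpha) => T0 S0 eS FT.
have [i iS] := set0Pn _ S0.
have [j] : exists j, j \in (T0 :\ i)%SET.
  apply/set0Pn; rewrite -cards_eq0; move: eS; rewrite (cardsD1 i) iS.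
  by case: #|_|.
rewrite !inE => /andP[ji jS]; exists i, j; split; first by rewrite eq_sym.
apply: (even_pair _ FT eS iS); rewrite ?inE // 1?eq_sym //.
move=> S T J FS FT' sJ oJ; have := rule S T J finset.set0 FS FT' sJ oJ.
by rewrite finset.setU0; apply; [exact: finset.sub0set|move=> k; rewrite inE].
Qed.

Lemma local_cone_full (K : op) : K \is hermsymmx -> L K.
Proof.
move=> hK; have [i [j [ij Fij]]] := contains_pair.
have F S : contains_type L S.
  have [->|S0] := eqVneq S finset.set0.
    move=> A tA; rewrite (eq_gtensor (B := fun=> 1%:M)) ?gtensor1.
      exact: (cone_scalar coneL (real1 _)).
    by move=> k; have [_] := tA k; rewrite inE.
  apply: (all_sets _ _ ij Fij S0).
    move=> S' T J FS FT' sJ oJ.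
    have := @contains_commutator _ _ _ d2 _ coneL S' T J finset.set0 FS FT' sJ oJ.
    by rewrite finset.setU0; apply; [exact: finset.sub0set|move=> k; rewrite inE].
  move=> S' S1 S2; have [alpha ha sa] := connected S1 S2.
  by exists (gm_coupled alpha) => //; exact: contains_term.
rewrite [K]gm_tensor_expand; apply: (cone_sum coneL) => alpha _.
apply: (cone_scale d0 coneL); last exact: F (gm_tensor_type alpha).
by rewrite realM ?realV // mxtrace_herm_real ?gm_tensor_herm.
Qed.
End GellMannTensor.

(** * Circuits *)

Section OpNorm.
Variables (R : realType) (N : nat).
Local Notation normc := (@Normc.normc R).
Implicit Types (A : 'M[R[i]]_N) (v : 'cV[R[i]]_N).

Lemma normc_le_l2norm v i : normc (v i 0) <= l2norm v.
Proof.
rewrite -[leLHS]ger0_norm ?normc_ge0 // -sqrtr_sqr ler_wsqrtr //.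
by rewrite (bigD1 i) //= lerDl sumr_ge0 // => k _; rewrite exprn_ge0 // normc_ge0.
Qed.

Lemma l2norm_le_sum v : l2norm v <= \sum_i normc (v i 0).
Proof.
have s0 : 0 <= \sum_i normc (v i 0) by apply: sumr_ge0 => i _; exact: normc_ge0.
rewrite -[leRHS]ger0_norm // -sqrtr_sqr ler_wsqrtr // expr2 mulr_suml.
apply: ler_sum => i _; rewrite expr2 ler_wpM2l ?normc_ge0 //.
by rewrite (bigD1 i) //= lerDl sumr_ge0 // => k _; exact: normc_ge0.
Qed.

Lemma l2norm_mul_le A v : l2norm v <= 1 -> l2norm (A *m v) <= mxnorm A.
Proof.
move=> v1; apply: le_trans (l2norm_le_sum _) _; apply: ler_sum => i _.
rewrite mxE; apply: le_trans (normc_sum _) _; apply: ler_sum => j _.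
rewrite Normc.normcM ler_piMr ?normc_ge0 //.
exact: le_trans (normc_le_l2norm _ _) v1.
Qed.

Lemma opnorm_le A : opnorm A <= mxnorm A.
Proof.
apply: ge_sup.
  exists (l2norm (A *m 0)), 0 => //=.
  apply: le_trans (l2norm_le_sum _) _.
  by rewrite big1 // => i _; rewrite mxE Normc.normc0.
by move=> _ [v /= v1 <-]; exact: l2norm_mul_le.
Qed.

Lemma normc_le_opnorm A i j : normc (A i j) <= opnorm A.
Proof.
apply: (@le_trans _ _ (l2norm (A *m delta_mx j 0))).
  apply: le_trans _ (normc_le_l2norm _ i); rewrite mxE (bigD1 j) //= big1 ?addr0.
    by rewrite mxE !eqxx mulr1.
  by move=> k /negbTE kj; rewrite mxE kj mulr0.
apply: ub_le_sup.
  by exists (mxnorm A) => _ [v /= v1 <-]; exact: l2norm_mul_le.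
exists (delta_mx j 0) => //=; apply: le_trans (l2norm_le_sum _) _.
rewrite (bigD1 j) //= big1 ?addr0; first by rewrite mxE !eqxx Normc.normc1.
by move=> k /negbTE kj; rewrite mxE kj Normc.normc0.
Qed.

Lemma opnorm_ge0 A : 0 <= opnorm A.
Proof.
apply: (@le_trans _ _ (l2norm (A *m 0))); first exact: sqrtr_ge0.
apply: ub_le_sup; first by exists (mxnorm A) => _ [v /= v1 <-]; exact: l2norm_mul_le.
exists 0 => //=; apply: le_trans (l2norm_le_sum _) _.
by rewrite big1 // => i _; rewrite mxE Normc.normc0.
Qed.

Lemma mxnorm_le_opnorm A : mxnorm A <= (N * N)%:R * opnorm A.
Proof.
rewrite natrM -mulrA /mxnorm; apply: (@le_trans _ _ (\sum_(i < N) \sum_(j < N) opnorm A)).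
  by do 2!apply: ler_sum => ? _; exact: normc_le_opnorm.
by rewrite !sumr_const card_ord -[leLHS]mulr_natl -[opnorm A *+ N]mulr_natl.
Qed.
End OpNorm.

Lemma gell_mann_spec (R : realType) (d : nat) (p : 'I_d * 'I_d) : gm_spec p
  (gell_mann R p).
Proof.
have s2 : (Num.sqrt 2)^-1%:C != 0 :> R[i].
  by rewrite fmorph_eq0 invr_eq0 gt_eqF // sqrtr_gt0.
have rC (x : R) : x%:C \is @Num.real R[i] by rewrite complex_real.
case: p => a b; rewrite /gell_mann /=.
have [ab|ab|/val_inj <-] := ltngtP a b.
- by apply: GmX.
- by apply: GmY.
case: eqP => [a0|/eqP]; first exact: GmOne.
rewrite -lt0n => a0; apply: GmW => //.
rewrite fmorph_eq0 invr_eq0 gt_eqF // sqrtr_gt0 ltr0n muln_gt0 a0 //.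
Qed.

Section Circuits.
Variables (R : realType) (n : nat) (d : 'I_n -> nat) (H : operator R d).

Lemma circuitM (A B : operator R d) : circuit H A -> circuit H B -> circuit H (A *m B).
Proof.
move=> cA cB; elim: cA => [|s A' s0 _ IH|U A' uU _ IH].
- by rewrite mul1mx.
- by rewrite -mulmxA; exact: circuit_evolution.
- by rewrite -mulmxA; exact: circuit_local.
Qed.

Lemma circuit_tensor (U : forall j : 'I_n, 'M[R[i]]_(d j)) :
  (forall j, U j \is unitarymx) -> circuit H (gtensor U).
Proof.
by move=> uU; have := circuit_local uU (circuit_id H); rewrite mulmx1.
Qed.

Hypothesis hH : hamiltonian H.

Lemma circuit_unitary (A : operator R d) : circuit H A -> A \is unitarymx.
Proof.
elim=> [|s A' s0 _ IH|U A' uU _ IH].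
- by apply/unitarymxP; rewrite trmx1 map_mx1 mulmx1.
- apply: mul_unitarymx IH; exact: evol_unitary.
- apply: mul_unitarymx IH; exact: gtensor_unitary.
Qed.

Local Notation simH := (simulated (circuit H)).

Lemma simulated_self : simH H.
Proof.
split=> [|t t0]; first exact: hH.
apply: approximable_circ; have := circuit_evolution t0 (circuit_id H); by rewrite mulmx1.
Qed.

Lemma can_simulateP (K : operator R d) : hamiltonian K -> simH K <-> can_simulate H K.
Proof.
move=> hK; split=> [[_ h] t t0 e e0|h].
  by have [A cA hA] := h t t0 e e0; exists A => //; apply: le_lt_trans hA;
    exact: opnorm_le.
split=> [|t t0 e e0]; first exact: hK.
(* m compares the two norms; dividing by m + 1 keeps the divisor visibly positive. *)
pose m : R := (#|config d| * #|config d|)%:R.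
have m0 : 0 < m + 1 by rewrite ltr_wpDl.
have e1 : 0 < e / (m + 1) by rewrite divr_gt0.
have [A cA hA] := h t t0 _ e1; exists A; first exact: cA.
apply: le_lt_trans (mxnorm_le_opnorm _) _.
apply: (@le_lt_trans _ _ ((m + 1) * opnorm (A - evolution K t))).
  by rewrite ler_wpM2r ?opnorm_ge0 // lerDl.
by rewrite mulrC -ltr_pdivlMr.
Qed.

Lemma simulated_local_cone (j0 : 'I_n) : local_cone simH.
Proof.
split.
- by move=> K [].
- move=> K K'; apply: simulatedD;
  [exact: circuit_id|exact: circuitM|exact: circuit_unitary].
- move=> c K c0; have rc : c \is Num.real by exact: ger0_real.
  have c0' : 0 <= complex.Re c by rewrite -ler0c RRe_real.
  by rewrite -(RRe_real rc); apply: simulatedZ.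
- move=> U K uU; apply: simulated_conj;
  [exact: circuitM|exact: circuit_unitary|exact: gtensor_unitary| |].
    by apply: approximable_circ; exact: circuit_tensor.
  rewrite gtensor_adj; apply: approximable_circ; apply: circuit_tensor => j.
  by rewrite trmxC_unitary.
- move=> c rc; rewrite -(RRe_real rc); set r := complex.Re c.
  split=> [|t t0].
    apply/hermsymmxP; rewrite tr_scalar_mx map_scalar_mx; congr (_%:M); exact: conjc_real.
  rewrite evol_scalar; apply: approximable_circ.
  (* A global phase is a local unitary: it is put entirely on the qudit j0. *)
  have -> : (cis (- (t * r)))%:M =
    gtensor (fun j => (if j == j0 then cis (- (t * r)) else 1)%:M) :> operator R d.
    by rewrite gtensor_scalar -big_mkcond big_pred1_eq.
  apply: circuit_tensor => j; apply/unitarymxP;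
    rewrite tr_scalar_mx map_scalar_mx -scalar_mxM.
  by congr (_%:M); case: ifP => _; rewrite ?rmorph1 ?mulr1 //; exact: cisMJ.
- move=> K K' sK sNK sK' sNK'.
  (* The arguments are exchanged because the two brackets differ in sign. *)
  have := simulated_commutator (circuit_id H) circuitM circuit_unitary sK' sNK' sK sNK.
  by rewrite -[K' *m K - _]opprB scalerN scaleNr opprK.
Qed.
End Circuits.

Section Terms.
Variables (R : realType) (n : nat) (d : 'I_n -> nat) (H : operator R d).
Hypothesis hH : hamiltonian H.

Lemma gm_basisE (alpha : gm_index d) :
  gm_basis R alpha = gm_tensor (fun j => @gell_mann R (d j)) alpha.
Proof. by []. Qed.

Definition gm_coef (alpha : gm_index d) : R[i] :=
  \tr (gm_basis R alpha *m H) / \tr (gm_basis R alpha *m gm_basis R alpha).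

Let specP j p : gm_spec p (@gell_mann R (d j) p) := gell_mann_spec R p.

Lemma gm_coef_real alpha : gm_coef alpha \is Num.real.
Proof.
have hb := gm_tensor_herm specP alpha.
by apply: realM; rewrite ?realV; apply: mxtrace_herm_real;
  [exact: hb|exact: hH|exact: hb|exact: hb].
Qed.

Lemma gm_coef_expansion : H = \sum_alpha gm_coef alpha *: gm_basis R alpha.
Proof. exact: gm_tensor_expand specP H. Qed.

(** Orthogonality forces the coefficients of any expansion, which turns the existential [gm_term]
    into a condition on one explicit number. *)
Lemma gm_termP alpha : gm_term H alpha <-> gm_coef alpha != 0.
Proof.
split=> [[h e ha]|h0].
  have b0 := gm_tensor_norm specP alpha.
  rewrite /gm_coef [in X in X / _]e.
  have := mxtrace_gm_tensor_sum specP (fun beta => (h beta)%:C) alpha => ->.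
  by rewrite mulfK // fmorph_eq0.
exists (fun beta => complex.Re (gm_coef beta)).
  rewrite /gm_expansion {1}gm_coef_expansion; apply: eq_bigr => beta _.
  by rewrite RRe_real // gm_coef_real.
by apply: contraNneq h0 => h0; rewrite -(RRe_real (gm_coef_real alpha)) h0.
Qed.

Lemma universal_of_not_odd : (2 <= n)%N -> (forall j, (2 <= d j)%N) ->
  connects_all H -> ~ odd_hamiltonian H -> universal H.
Proof.
move=> n2 d2 cH oH K hK.
apply: (can_simulateP H hK).1.
have n0 : (0 < n)%N by exact: ltnW.
have coneH := simulated_local_cone hH (Ordinal n0).
apply: (local_cone_full specP d2 coneH (simulated_self hH) gm_coef_expansion n2 _ _ hK).
  move=> S S0 S1; apply: contrapT => h; apply: cH; exists S; split=> // alpha [ta _].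
  apply: contrapT => /negP; rewrite negb_or => hS; apply: h.
  by exists alpha => //; exact/gm_termP.
apply: contrapT => h; apply: oH; split=> [j|alpha [ta a0]].
  apply/eqP; rewrite eqn_leq d2 andbT leqNgt; apply/negP => dj; apply: h.
  by left; exists j.
apply: contrapT => /negP oa; apply: h; right; exists alpha; split=> //.
exact/gm_termP.
Qed.
End Terms.

(** * Odd Hamiltonians *)

Section Qubit.
Variables (C : numClosedFieldType) (d : nat) (k l : 'I_d).
Hypotheses (kl : k != l) (ddef : d = 2%N).
Local Notation sy := (twolevelY C k l).

Let qubit_cases (a : 'I_d) : a = k \/ a = l.
Proof.
have := ltn_ord a; have := ltn_ord k; have := ltn_ord l.
have : k <> l :> nat by move=> e; move: kl; rewrite (val_inj e) eqxx.
move=> ne hl hk ha; have [e|e] := eqVneq (val a) (val k); [left|right];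
  apply: val_inj => //=.
by move/eqP: e => /=; move: ddef ne hl hk ha; lia.
Qed.

Lemma twolevelY_tr_mx : sy^T = - sy.
Proof. by rewrite /twolevelY linearZ linearB /= !trmx_delta -scalerN opprB. Qed.

Let lk : (l == k) = false. Proof. by rewrite eq_sym; exact: negbTE. Qed.

Lemma twolevelYK : sy *m sy = 1%:M.
Proof.
rewrite (twolevelYY C kl) /twolevel1; apply/matrixP => a b; rewrite !mxE.
by case: (qubit_cases a) => ->; case: (qubit_cases b) => ->;
  rewrite ?eqxx ?lk ?(negbTE kl) /= ?addr0 ?add0r.
Qed.

(** Antisymmetric 2 x 2 matrices form a line, which is where dimension 2 enters the converse. *)
Lemma antisym_twolevelY (A : 'M[C]_d) : A^T = - A -> exists c, A = c *: sy.
Proof.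
move=> aA; have E a b : A a b = - A b a by have /matrixP/(_ b a) := aA; rewrite !mxE.
have D a : A a a = 0.
  by apply/eqP; have /eqP := E a a; rewrite -addr_eq0 -mulr2n mulrn_eq0.
have iA : - 'i * A l k * 'i = A l k by rewrite mulrAC mulNr -expr2 sqrCi opprK mul1r.
exists (- 'i * A l k); apply/matrixP => a b; rewrite !mxE mulrA iA.
case: (qubit_cases a) => ->; case: (qubit_cases b) => ->;
  rewrite ?eqxx ?lk ?(negbTE kl) /= ?D ?subrr ?mulr0 ?subr0 ?mulr1 //.
by rewrite sub0r mulrN1 -E.
Qed.

(** tr X - X is the adjugate of X. The matrix X^T Y + Y X is antisymmetric, hence c Y; multiplying
    by Y and taking traces gives 2c = 2 tr X. *)
Lemma twolevelY_spinflip (X : 'M[C]_d) : X^T *m sy = sy *m ((\tr X)%:M - X).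
Proof.
have [c e] : exists c, X^T *m sy + sy *m X = c *: sy.
  apply: antisym_twolevelY; rewrite linearD /= !trmx_mul trmxK twolevelY_tr_mx.
  by rewrite mulNmx mulmxN opprD addrC.
have -> : \tr X = c.
  have dR : d%:R = 2 :> C by rewrite ddef.
  have := congr1 (fun Z => \tr (Z *m sy)) e.
  rewrite mulmxDl -mulmxA twolevelYK mulmx1 mxtraceD mxtrace_tr
    [\tr (_ *m sy)]mxtrace_mulC.
  rewrite mulmxA twolevelYK mul1mx -scalemxAl twolevelYK mxtraceZ mxtrace1 dR -mulr2n
    -[_ *+ 2]mulr_natl [c * _]mulrC.
  by move/mulfI; apply; rewrite pnatr_eq0.
by rewrite mulmxBr mul_mx_scalar -e addrK.
Qed.
End Qubit.

Lemma udiag_tr (C : numClosedFieldType) N (P : 'M[C]_N) (y : 'I_N -> C) :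
  (udiag P y)^T = udiag (map_mx Num.conj P) y.
Proof.
rewrite /udiag !trmx_mul tr_diag_mx mulmxA; congr (_ *m _ *m _).
  by rewrite -map_trmx -map_mx_comp map_mx_id // => z; exact: conjCK.
by rewrite map_trmx trmxK.
Qed.

Section OddDirection.
Variables (R : realType) (n : nat) (d : 'I_n -> nat) (H : operator R d).
Hypotheses (n2 : (2 <= n)%N) (d2 : forall j, (2 <= d j)%N).
Local Notation op := 'M[R[i]]_#|config d|.

Let lev0 j : 'I_(d j) := Ordinal (ltnW (d2 j)).
Let lev1 j : 'I_(d j) := Ordinal (d2 j).
Let lev01 j : lev0 j != lev1 j. Proof. by []. Qed.

Definition spinflip : op := gtensor (fun j => twolevelY R[i] (lev0 j) (lev1 j)).
Local Notation J := spinflip.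

Hypothesis dE : forall j, d j = 2%N.

Lemma spinflipK : J *m J = 1%:M.
Proof. by rewrite gtensorM -gtensor1; apply: eq_gtensor => j;
  exact: (@twolevelYK R[i] _ _ _ (lev01 j) (dE j)). Qed.

(** Each U^T Y U is again antisymmetric, hence a multiple of Y; the factor is the determinant of
    U. *)
Lemma spinflip_local (U : forall j, 'M[R[i]]_(d j)) :
  exists c, (gtensor U)^T *m J *m gtensor U = c *: J.
Proof.
have /choice [c hc] j : exists c, (U j)^T *m twolevelY R[i] (lev0 j) (lev1 j) *m U j =
    c *: twolevelY R[i] (lev0 j) (lev1 j).
  apply: (antisym_twolevelY (lev01 j) (dE j)).
  by rewrite !trmx_mul trmxK twolevelY_tr_mx mulNmx mulmxN mulmxA.
exists (\prod_j c j); rewrite gtensor_tr !gtensorM -gtensorZ.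
by apply: eq_gtensor => j; exact: hc.
Qed.

Lemma evol_tr (N : nat) (K : 'M[R[i]]_N) t : K \is hermsymmx ->
  (evol K t)^T = evol (K^T) t.
Proof.
move=> /hermitian_udiag [P [x [uP ->]]].
have uP' : map_mx Num.conj P \is unitarymx by rewrite conjC_unitary.
apply: etrans (congr1 trmx (evol_udiag x t uP)) _; apply: etrans (udiag_tr _ _) _.
apply: etrans (esym (evol_udiag x t uP')) _.
by apply: (congr1 (fun Z => evol Z t)); apply: esym; exact: udiag_tr.
Qed.

Lemma evol_complement (N : nat) (K : 'M[R[i]]_N) e t : K \is hermsymmx ->
  evol ((e%:C)%:M - K) t *m evol K t = (cis (- (t * e)))%:M.
Proof.
move=> /hermitian_udiag [P [x [uP ->]]].
have -> : (e%:C)%:M - udiag P (fun k => (x k)%:C) = udiag P (fun k => (e - x k)%:C).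
  rewrite -(udiag_cst uP) -scaleN1r.
  apply: etrans (congr1 (+%R _) (udiagZ _ _ _)) _.
  apply: etrans (udiagD _ _ _) _; apply: eq_udiag => k.
  by rewrite mulN1r rmorphB.
apply: etrans (congr2 mulmx (evol_udiag (fun k => e - x k) t uP) (evol_udiag x t uP)) _.
apply: etrans (udiagM uP _ _) _; apply: etrans _ (udiag_cst uP _).
by apply: eq_udiag => k; rewrite -cisD; congr cis; ring.
Qed.

Hypotheses (hH : hamiltonian H) (oH : odd_hamiltonian H).

Let specP j p : gm_spec p (@gell_mann R (d j) p) := gell_mann_spec R p.

Lemma spinflip_basis (alpha : gm_index d) :
  (gm_basis R alpha)^T *m J = (-1) ^+ #|coupled_set R alpha| *: (J *m gm_basis R alpha).
Proof.
have [_ tg] := (fun j => (gm_tensor_type specP alpha j).1, gm_tensor_type specP alpha).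
rewrite gm_basisE /gm_tensor gtensor_tr !gtensorM -prodr_const big_mkcond -gtensorZ.
apply: eq_gtensor => j; rewrite (twolevelY_spinflip (lev01 j) (dE j)).
have [_] := tg j; rewrite -[gm_coupled _ _]/(coupled_set R alpha).
case: (j \in _) => [-> | ->].
  by rewrite raddf0 sub0r mulmxN scaleN1r.
rewrite mxtrace1 scale1r; congr (_ *m _); rewrite -raddfB /=; congr (_%:M).
by rewrite dE mulr2n addrK.
Qed.

Lemma gm_basis_uncoupled (alpha : gm_index d) :
  coupled_set R alpha = finset.set0 -> gm_basis R alpha = 1%:M.
Proof.
move=> S0; rewrite gm_basisE -gtensor1; apply: eq_gtensor => j.
by have [_] := gm_tensor_type specP alpha j;
  rewrite -[gm_coupled _ _]/(coupled_set R alpha) S0 inE.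
Qed.

Lemma spinflip_odd : exists e : R, H^T *m J = J *m ((e%:C)%:M - H).
Proof.
(* Only the identity term keeps its sign. Writing its coefficient g as 2g - g puts it in the form of
   a scalar minus the term. *)
pose e alpha := if coupled_set R alpha == finset.set0 then complex.Re (gm_coef H alpha)
  else 0.
have E alpha : gm_coef H alpha *: ((gm_basis R alpha)^T *m J) =
    J *m ((2 * e alpha)%:C%:M - gm_coef H alpha *: gm_basis R alpha).
  rewrite spinflip_basis /e; have [S0|S0] := eqVneq (coupled_set R alpha) finset.set0.
    rewrite S0 cards0 expr0 scale1r (gm_basis_uncoupled S0) mulmx1 rmorphM /= RRe_real
      ?gm_coef_real //.
    rewrite scalemx1 -raddfB /= mul_mx_scalar rmorph_nat; congr (_ *: _); ring.
  rewrite mulr0 raddf0 sub0r mulmxN -scalemxAr.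
  have [->|c0] := eqVneq (gm_coef H alpha) 0; first by rewrite !scale0r oppr0.
  have -> : (-1) ^+ #|coupled_set R alpha| = -1 :> R[i].
    by rewrite -signr_odd (oH.2 alpha) ?expr1 //; split=> //; apply/gm_termP.
  by rewrite scaleN1r scalerN.
exists (\sum_alpha 2 * e alpha).
have HT : H^T = \sum_alpha gm_coef H alpha *: (gm_basis R alpha)^T.
  apply: etrans (congr1 trmx (gm_coef_expansion H)) _.
  by rewrite linear_sum; apply: eq_bigr => alpha _; exact: linearZ.
rewrite HT mulmx_suml (eq_bigr _
  (fun alpha _ => etrans (esym (scalemxAl _ _ _)) (E alpha))).
rewrite -mulmx_sumr sumrB -gm_coef_expansion; congr (_ *m (_ - _)).
by rewrite rmorph_sum raddf_sum.
Qed.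

(** Moving J across the transposed evolution produces the evolution of e - H, which commutes with
    that of H and multiplies it to a phase. *)
Lemma spinflip_evol t : exists c, (evol H t)^T *m J *m evol H t = c *: J.
Proof.
have [e he] := spinflip_odd.
have hHT : H^T \is hermsymmx.
  apply/hermsymmxP; rewrite -map_trmx; move/hermsymmxP: hH => {2}<-.
  by rewrite map_trmx trmxK.
have hHe : (e%:C)%:M - H \is hermsymmx.
  apply/hermsymmxP; rewrite linearB /= map_mxB tr_scalar_mx map_scalar_mx.
  by move/hermsymmxP: hH => ->; congr (_%:M - _); exact: conjc_real.
exists (cis (- (t * e))).
rewrite (evol_tr t hH) (evol_intertwine t hHT hHe he) -mulmxA (evol_complement e t hH).
by rewrite mul_mx_scalar.
Qed.

Lemma circuit_spinflip (A : operator R d) : circuit H A ->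
  exists c, A^T *m J *m A = c *: J.
Proof.
have step (X A' : op) c c' : X^T *m J *m X = c' *: J -> A'^T *m J *m A' = c *: J ->
    exists c, (X *m A')^T *m J *m (X *m A') = c *: J.
  move=> hX hA; exists (c' * c); rewrite trmx_mul.
  have -> : A'^T *m X^T *m J *m (X *m A') =
    A'^T *m (X^T *m J *m X) *m A' by rewrite !mulmxA.
  by rewrite hX -scalemxAr -scalemxAl hA scalerA.
elim=> [|s A' _ _ [c hc]|U A' _ _ [c hc]].
- by exists 1; rewrite trmx1 mul1mx mulmx1 scale1r.
- by have [c' hc'] := spinflip_evol s; exact: step hc' hc.
- by have [c' hc'] := spinflip_local U; exact: step hc' hc.
Qed.

Let j0 : 'I_n := Ordinal (ltnW n2).
Let j1 : 'I_n := Ordinal n2.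

(** An even coupling, so it commutes with J; as a non-scalar involution it also has an explicit
    evolution. *)
Definition witness : op := gtensor (fun j => if j \in [set j0; j1]%SET
  then twolevelZ R[i] (lev0 j) (lev1 j) else 1%:M).
Local Notation K := witness.

Lemma witness_herm : K \is hermsymmx.
Proof.
apply/hermsymmxP; rewrite gtensor_adj; apply: eq_gtensor => j; apply/hermsymmxP.
by case: ifP => _; [exact: twolevelZ_herm|apply/hermsymmxP; rewrite trmx1 map_mx1].
Qed.

Lemma witness_tr : K^T = K.
Proof.
rewrite gtensor_tr; apply: eq_gtensor => j; case: ifP => _; last exact: trmx1.
by rewrite linearB /= !trmx_delta.
Qed.

Lemma witnessK : K *m K = 1%:M.
Proof.
rewrite gtensorM -gtensor1; apply: eq_gtensor => j; case: ifP => _; last exact: mul1mx.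
by rewrite (twolevelZZ _ (lev01 j)) -(twolevelYY _ (lev01 j))
  (twolevelYK _ (lev01 j) (dE j)).
Qed.

Lemma witness_comm : K *m J = J *m K.
Proof.
have <- : (-1) ^+ #|[set j0; j1]%SET| *: (J *m K) =
  J *m K by rewrite cards2 sqrrN expr1n scale1r.
rewrite !gtensorM -prodr_const big_mkcond -gtensorZ; apply: eq_gtensor => j.
case: ifP => _; last by rewrite mul1mx mulmx1 scale1r.
have tZ : (twolevelZ R[i] (lev0 j) (lev1 j))^T = twolevelZ R[i] (lev0 j) (lev1 j).
  by rewrite linearB /= !trmx_delta.
rewrite -[in LHS]tZ (twolevelY_spinflip (lev01 j) (dE j)) twolevelZ_tr raddf0 sub0r.
by rewrite mulmxN scaleN1r.
Qed.

Lemma witness_trace : \tr K = 0.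
Proof. by rewrite mxtrace_gtensor (bigD1 j0) //= !inE eqxx twolevelZ_tr mul0r. Qed.

Lemma witness_entry : exists x, K x x = 1.
Proof.
pose f : config d := [ffun j => lev0 j].
have fE j : digit (enum_rank f) j = lev0 j by rewrite /digit enum_rankK ffunE.
exists (enum_rank f); rewrite mxE big1 // => j _; rewrite fE.
by case: ifP => _; rewrite !mxE ?eqxx // (negbTE (lev01 j)) subr0.
Qed.

(** The eigenvalues are 1 and -1, and e^(-i pi x / 2) = -i x for both. *)
Lemma evol_witness : evol K (pi / 2) = - 'i *: K.
Proof.
have /hermitian_udiag [P [x [uP KE]]] := witness_herm.
have x2 k : x k ^+ 2 = 1.
  have := witnessK; rewrite KE (udiagM uP).
  move=> /(congr1 (fun Z => P *m Z *m P^t*));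
    rewrite /udiag !mulmxA (unitarymxP uP) mul1mx.
  rewrite -mulmxA (unitarymxP uP) !mulmx1 (unitarymxP uP) => /matrixP /(_ k k).
  by rewrite !mxE eqxx !mulr1n -rmorphM => /complexI.
rewrite KE; apply: etrans (evol_udiag x _ uP) _; apply: etrans _ (esym (udiagZ _ _ _)).
apply: eq_udiag => k.
have : (x k == 1) || (x k == -1) by rewrite -eqf_sqr x2 expr1n.
case/orP => /eqP ->.
  by rewrite mulr1 /cis cosN sinN cos_pihalf sin_pihalf; simpc.
by rewrite mulrN1 opprK /cis cos_pihalf sin_pihalf; simpc.
Qed.

Lemma mxnorm_tr (N : nat) (A : 'M[R[i]]_N) : mxnorm (A^T) = mxnorm A.
Proof.
by rewrite /mxnorm exchange_big; do 2!apply: eq_bigr => ? _; rewrite mxE.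
Qed.

Lemma odd_not_universal : ~ universal H.
Proof.
move=> /(_ _ witness_herm)/(can_simulateP H witness_herm).2 [_ simK].
(* As K is symmetric and commutes with J, [D E] is the square of E, the evolution for time pi / 2;
   at t = pi / 4 this is -iK, which is not scalar. *)
pose t : R := pi / 4.
have t0 : 0 <= t by rewrite divr_ge0 // pi_ge0.
pose E := evol K t; pose D (X : op) := X^T *m J *m X *m J.
have DE : D E = - 'i *: K.
  rewrite /D /E (evol_tr t witness_herm) witness_tr.
  rewrite -(mulmxA (evol K t))
    -(evol_intertwine t witness_herm witness_herm witness_comm).
  rewrite !mulmxA -mulmxA spinflipK mulmx1 -evol_witness.
  have -> : evol K t *m evol K t = evol K t ^+ 2 by rewrite expr2.
  by rewrite (evolX _ _ witness_herm) /t; congr evol; field.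
(* A Lipschitz constant for [D] between E and any unitary, whose norm is at most the square of the
   dimension. *)
pose b : R := mxnorm J ^+ 2 * (mxnorm E + (#|config d| * #|config d|)%:R).
have b0 : 0 <= b by rewrite mulr_ge0 ?exprn_ge0 ?addr_ge0 ?mxnorm_ge0.
(* [D A] is scalar for each circuit A, so approximation forces a constant diagonal on [D E]. Two
   entries each cost b times the distance, whence 2b, and the 1 keeps the divisor positive. *)
have Deq x y : D E x x = D E y y.
  apply/eqP; rewrite -subr_eq0; apply/eqP/Normc.eq0_normc.
  apply/le_anti; rewrite normc_ge0 andbT leNgt; apply/negP.
  set v := Normc.normc _ => v0.
  have e0 : 0 < v / (2 * b + 1) by rewrite divr_gt0 // ltr_wpDl // mulr_ge0.
  have [A cA hA] := simK t t0 _ e0.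
  have [c hc] := circuit_spinflip cA.
  have DA : D A = c%:M by rewrite /D hc -scalemxAl spinflipK scalemx1.
  have nD : mxnorm (D E - D A) <= b * mxnorm (A - E).
    have -> : D E - D A = (E^T *m J *m (E - A) *m J) + ((E - A)^T *m J *m A *m J).
      rewrite [(E - A)^T]linearB /= /D mulmxBr !mulmxBl.
      by rewrite addrA subrK.
    apply: le_trans (mxnormD _ _) _.
    have n3 (X Y : op) : mxnorm (X *m J *m Y *m J) <=
      mxnorm X * mxnorm J * mxnorm Y * mxnorm J.
      apply: le_trans (mxnormM _ _) _; apply: (ler_wpM2r (mxnorm_ge0 _)).
      apply: le_trans (mxnormM _ _) _; apply: (ler_wpM2r (mxnorm_ge0 _)).
      exact: mxnormM.
    have h1 := n3 (E^T) (E - A); have h2 := n3 ((E - A)^T) A.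
    rewrite !mxnorm_tr in h1 h2; rewrite (mxnorm_distC E A) in h1 h2.
    have uA := mxnorm_unitary (circuit_unitary hH cA).
    have h3 : mxnorm (A - E) * mxnorm J * mxnorm A * mxnorm J <=
        mxnorm (A - E) * mxnorm J * (#|config d| * #|config d|)%:R * mxnorm J.
      apply: (ler_wpM2r (mxnorm_ge0 _)); apply: ler_wpM2l uA.
      by rewrite mulr_ge0 ?mxnorm_ge0.
    apply: le_trans (lerD h1 (le_trans h2 h3)) _.
    by rewrite /b le_eqVlt; apply/orP; left; apply/eqP; ring.
  have hv : v <= 2 * (b * mxnorm (A - E)).
    rewrite /v; have -> : D E x x - D E y y = (D E - D A) x x - (D E - D A) y y.
      by rewrite DA; move: (D E) => Z; rewrite !mxE !eqxx; ring.
    apply: le_trans (normcD _ _) _; rewrite normcNE mulr2n mulrDl mul1r.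
    by apply: lerD; apply: le_trans (mxnorm_entry _ _ _) nD.
  have : v < v.
    apply: (le_lt_trans hv).
    have b1 : 0 < 2 * b + 1 by rewrite ltr_wpDl // mulr_ge0.
    move: hA; rewrite ltr_pdivlMr // => hA; apply: le_lt_trans hA.
    by rewrite mulrA [leRHS]mulrC ler_wpM2r ?mxnorm_ge0 // lerDl.
  by rewrite ltxx.
(* A constant diagonal of -iK with one entry of K equal to 1 makes the trace of K the dimension, yet
   it is 0. *)
have [x Kx] := witness_entry.
have K1 y : K y y = 1.
  have S z : D E z z = - 'i * K z z by rewrite DE [LHS]mxE.
  have := Deq y x; rewrite !S Kx => /mulfI; apply.
  by rewrite oppr_eq0 -complexiE neq0Ci.
have := witness_trace; rewrite /mxtrace (eq_bigr (fun=> 1)); last by move=> y _;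
  exact: K1.
rewrite sumr_const card_ord => /eqP; rewrite pnatr_eq0.
by rewrite -leqn0 leqNgt (leq_ltn_trans _ (ltn_ord x)).
Qed.
End OddDirection.

Theorem theorem6 (R : realType) (n : nat) (d : 'I_n -> nat) (H : operator R d) :
  (2 <= n)%N ->
  (forall j : 'I_n, (2 <= d j)%N) ->
  hamiltonian H ->
  connects_all H ->
  universal H <-> ~ odd_hamiltonian H.
Proof.
move=> n2 d2 hH cH; split=> [uH oH|].
  exact: (odd_not_universal n2 d2 oH.1 hH oH uH).
exact: universal_of_not_odd.
Qed.
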